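(* Let $N,k$ be positive integers with $k\le N$, let $X$ be a compact subset of $\mathbb{R}^N$ and let $\mu$ be a finite Borel measure supported on $X$. Consider orthogonal projections $P_V\colon \mathbb{R}^N \to V$ onto $k$-dimensional linear spaces $V \subset \mathbb{R}^N$. Then the following hold. (i) If $\dim_H X < k$, then for almost every $V$ there exists a full $\mu$-measure Borel set $X_V \subset X$ such that the restriction of $P_V$ to $X_V$ is injective with continuous inverse $(P_V|_{X_V})^{-1}\colon P_V(X_V)\to X_V$. (ii) If $\overline{\dim}_B X < k$, then for almost every $V$ there exists a full $\mu$-measure Borel set $X_V \subset X$ such that the restriction of $P_V$ to $X_V$ is injective with inverse which is pointwise $\alpha$-Hölder for every $\alpha \in \big(0, 1 - \frac{\overline{\dim}_B X}{k}\big)$. (iii) If $\dim_A X < k$, then for almost every $V$ there exists a full $\mu$-measure Borel set $X_V \subset X$ such that the restriction of $P_V$ to $X_V$ is injective with inverse which is pointwise $\alpha$-Hölder for every $\alpha \in (0,1)$.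
   Context: ''Almost every $V$'' refers to the rotation-invariant (Haar) measure on the Grassmannian $\mathrm{Gr}(k,N)$ of $k$-dimensional linear subspaces of $\mathbb{R}^N$. A map $\phi\colon A \to \mathbb{R}^N$, where $A$ is a subset of a Euclidean space (here of $V \simeq \mathbb{R}^k$), is pointwise $\alpha$-Hölder if for every $x \in A$ there exists $c_x > 0$ such that $\|\phi(x)-\phi(y)\| \le c_x\|x-y\|^\alpha$ for every $y \in A$. $\dim_H$ is the Hausdorff dimension. For bounded $X\subset\mathbb{R}^N$ and $\delta>0$ let $N(X,\delta)$ be the minimal number of balls of radius $\delta$ needed to cover $X$; the upper box-counting dimension is $\overline{\dim}_B X = \limsup_{\delta\to0} \frac{\log N(X,\delta)}{-\log\delta}$. A bounded set $X$ is $(M,s)$-homogeneous if $N(X\cap B(x,r),\rho) \le M(r/\rho)^s$ for every $x\in X$ and $0<\rho<r$; the Assouad dimension is $\dim_A X = \inf\{s>0 : X \text{ is } (M,s)\text{-homogeneous for some } M>0\}$. *)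

(* Defs.v *)
From HB Require Import structures.
From mathcomp Require Import all_boot all_order all_algebra.
From mathcomp Require Import all_classical all_reals all_analysis.

Set Implicit Arguments.
Unset Strict Implicit.
Unset Printing Implicit Defensive.

Import Order.TTheory GRing.Theory Num.Theory.
Import numFieldNormedType.Exports.

Local Open Scope classical_set_scope.
Local Open Scope ring_scope.

Section Euclidean.
Context {R : realType} {N : nat}.
Implicit Types (x y u v : 'rV[R]_N) (V : {vspace 'rV[R]_N}).

Definition dotv u v : R := \sum_(i < N) u 0 i * v 0 i.

Lemma dotvC u v : dotv u v = dotv v u.
Proof. by apply: eq_bigr => i _; rewrite mulrC. Qed.

Fact dotv_is_bilinear :
  bilinear_for (GRing.Scale.Law.clone _ _ *%R _)
    (GRing.Scale.Law.clone _ _ (idfun \; *%R) _) dotv.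
Proof.
split=> [v|u] a x y /=.
  rewrite /dotv mulr_sumr -big_split; apply: eq_bigr => i _ /=.
  by rewrite !mxE mulrDl mulrA.
rewrite /dotv mulr_sumr -big_split; apply: eq_bigr => i _ /=.
by rewrite !mxE mulrDr mulrCA.
Qed.

HB.instance Definition _ :=
  bilinear_isBilinear.Build R _ _ R *%R (idfun \; *%R) dotv dotv_is_bilinear.

Fact dotv_is_hermitian u v : dotv u v = (-1) ^+ false * idfun (dotv v u).
Proof. by rewrite expr0 mul1r dotvC. Qed.

HB.instance Definition _ :=
  isHermitianSesquilinear.Build R _ false idfun dotv dotv_is_hermitian.

(* The norm and the balls of the library on ['rV[R]_N] are those of the sup
   norm; the topology is the same. *)
Definition enorm x : R := Num.sqrt (dotv x x).

Definition eball x (r : R) : set 'rV[R]_N := [set y | enorm (x - y) < r].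

(* Orthogonal projection onto V, i.e. projection onto V along its orthogonal
   complement; see [orthoproj_mem] and [orthoproj_orth]. *)
Definition orthoproj V : 'End('rV[R]_N) := daddv_pi V (orthov dotv V).

Lemma orthoproj_mem V x : orthoproj V x \in V.
Proof. exact: memv_pi. Qed.

Lemma dotv_eq0 x : dotv x x = 0 -> x = 0.
Proof.
move/eqP; rewrite psumr_eq0 => [/allP x0|i _]; last exact: sqr_ge0.
apply/rowP => i; rewrite mxE.
by have := x0 i (mem_index_enum i); rewrite /= mulf_eq0 orbb => /eqP.
Qed.

Lemma orthov_capv V : (V :&: orthov dotv V = 0)%VS.
Proof.
apply/eqP; rewrite -subv0; apply/subvP => x; rewrite memv_cap memv0.
by case/andP => Vx /mem_orthovP/(_ _ Vx)/dotv_eq0/eqP.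
Qed.

Lemma orthov_addv V : (V + orthov dotv V = fullv)%VS.
Proof.
have orthoS (s : seq 'rV[R]_N) : exists2 U : {vspace 'rV[R]_N},
    (N <= \dim U + size s)%N & forall u v, u \in U -> v \in s -> dotv u v = 0.
  elim: s => [|w s [U dimU Us]].
    by exists fullv => //; rewrite dimvf /dim /= mul1n addn0.
  exists (U :&: orthov dotv <[w]>)%VS => [|u v].
    have := leq_dim_orthov1 dotv w U.
    rewrite /= addnS; move: dimU; case: (\dim U) => [|d] //= dimU leU.
      by rewrite (leq_trans dimU)// ltnW// ltnS leq_add2r.
    by rewrite (leq_trans dimU)// addSn ltnS leq_add2r.
  rewrite memv_cap inE => /andP[Uu wu] /predU1P[->|]; last exact: Us.
  by move: wu; rewrite mem_orthov1 => /eqP.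
have [U dimU UV] := orthoS (vbasis V).
have sUV : (U <= orthov dotv V)%VS.
  apply/subvP => u Uu; apply/mem_orthovP => v /coord_vbasis ->.
  rewrite linear_sumr big1 //= => i _.
  by rewrite linearZr_LR /= UV ?mulr0 // mem_nth ?size_tuple.
apply/eqP; rewrite eqEdim subvf /= dimvf /dim /= mul1n.
rewrite dimv_disjoint_sum ?orthov_capv // (leq_trans dimU) //.
by rewrite size_tuple addnC leq_add2l dimvS.
Qed.

Lemma orthoproj_orth V x v : v \in V -> dotv (x - orthoproj V x) v = 0.
Proof.
move=> Vv; have xV : x \in (V + orthov dotv V)%VS by rewrite orthov_addv memvf.
have {1}<- := daddv_pi_add (orthov_capv V) xV.
rewrite addrC addKr.
by have /mem_orthovP/(_ _ Vv) := memv_pi (orthov dotv V) V x.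
Qed.

End Euclidean.

Section Grassmannian.
Context {R : realType} {k N : nat} {hkN : (k <= N)%N}.

(* The hypothesis makes the type inhabited, as measurable types must be. *)
Definition Gr of (k <= N)%N := {V : {vspace 'rV[R]_N} | \dim V == k}.

Fact Gr_inhabited :
  \dim (span (take k (vbasis {: 'rV[R]_N}))) == k.
Proof.
have /basis_free := vbasisP {: 'rV[R]_N}.
rewrite -[X in free X](cat_take_drop k) => /catl_free/eqP ->.
by rewrite size_takel // size_tuple dimvf /dim /= mul1n.
Qed.

HB.instance Definition _ := Choice.on (Gr hkN).
HB.instance Definition _ := isPointed.Build (Gr hkN)
  (exist (fun V : {vspace 'rV[R]_N} => \dim V == k) _ Gr_inhabited).

(* The standard topology of the Grassmannian: that of the metric
   (V, W) |-> |P_V - P_W|. *)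
Definition Gr_open : set (set (Gr hkN)) :=
  [set (fun V : Gr hkN => lin1_mx (orthoproj (\val V))) @^-1` O
     | O in (open : set (set 'M[R]_N))].

Definition GrBorel := g_sigma_algebraType Gr_open.

(* Q acts on row vectors, on the right. *)
Definition Gr_rotate (Q : 'M[R]_N) (A : set (Gr hkN)) : set (Gr hkN) :=
  [set V | exists2 W, A W & \val V = (linfun (mulmxr Q) @: \val W)%VS].

Definition rotation (Q : 'M[R]_N) : Prop := Q *m Q^T = 1%:M /\ \det Q = 1.

(* Rotations act transitively on the compact space of k-planes, so exactly one
   Borel probability measure has this property: the Haar measure. *)
Definition rotation_invariant (gamma : set GrBorel -> \bar R) : Prop :=
  forall Q : 'M[R]_N, rotation Q ->
  forall A : set GrBorel, measurable A -> gamma (Gr_rotate Q A) = gamma A.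

End Grassmannian.
Arguments Gr R {k N} _.
Arguments GrBorel R {k N} hkN.

Section Dimensions.
Context {R : realType} {N : nat}.
Implicit Types X U : set 'rV[R]_N.
Local Open Scope ereal_scope.

Definition ediam U : \bar R :=
  ereal_sup (0 |` [set (enorm (x - y))%:E | x in U & y in U]).

Definition hausdorff_content (s delta : R) X : \bar R :=
  ereal_inf [set \sum_(0 <= i <oo) ediam (U i) `^ s
    | U in [set U : nat -> set 'rV[R]_N |
        X `<=` \bigcup_i U i /\ forall i, ediam (U i) <= delta%:E]].

Definition hausdorff_measure (s : R) X : \bar R :=
  ereal_sup [set hausdorff_content s delta X | delta in [set d : R | (0 < d)%R]].

Definition hausdorff_dim X : \bar R :=
  ereal_inf [set s%:E | s in [set s : R | (0 < s)%R /\ hausdorff_measure s X = 0]].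

(* +oo when no finite family of balls covers X. *)
Definition covering_number X (delta : R) : \bar R :=
  ereal_inf [set n%:R%:E | n in [set n : nat |
    exists c : 'I_n -> 'rV[R]_N, X `<=` \bigcup_i eball (c i) delta]].

Definition upper_box_dim X : \bar R :=
  limf_esup (fun delta : R => lne (covering_number X delta) / (- ln delta)%:E)
    0^'+.

Definition homogeneous (M s : R) X : Prop :=
  forall x, X x -> forall r rho : R, (0 < rho)%R -> (rho < r)%R ->
  covering_number (X `&` eball x r) rho <= (M * (r / rho) `^ s)%:E.

Definition assouad_dim X : \bar R :=
  ereal_inf [set s%:E | s in [set s : R |
    (0 < s)%R /\ exists2 M : R, (0 < M)%R & homogeneous M s X]].

End Dimensions.

Definition pointwise_holder {R : realType} {m n : nat} (alpha : R)
    (A : set 'rV[R]_m) (phi : 'rV[R]_m -> 'rV[R]_n) : Prop :=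
  forall x, A x -> exists2 c : R, 0 < c &
    forall y, A y -> enorm (phi x - phi y) <= c * enorm (x - y) `^ alpha.

Definition Borel (R : realType) (N : nat) :=
  g_sigma_algebraType (open : set (set 'rV[R]_N)).

(* The inverse of f : A -> f(A); junk value 0 outside f(A). *)
Definition inverse_on {R : realType} {N : nat} (A : set 'rV[R]_N)
    (f : 'rV[R]_N -> 'rV[R]_N) : 'rV[R]_N -> 'rV[R]_N :=
  'pinv_(fun=> 0) A f.

Definition full_borel_subset {R : realType} {N : nat}
    (mu : set (Borel R N) -> \bar R) (X A : set (Borel R N)) : Prop :=
  [/\ measurable A, A `<=` X & mu (~` A) = 0%E].

(* Main.v *)
Require Import Defs.
From HB Require Import structures.
From mathcomp Require Import all_boot all_order all_algebra.
From mathcomp Require Import all_classical all_reals all_analysis.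
From mathcomp Require Import measurable_realfun ring lra.

Set Implicit Arguments.
Unset Strict Implicit.
Unset Printing Implicit Defensive.

Import Order.TTheory GRing.Theory Num.Theory.
Import numFieldNormedType.Exports.

Local Open Scope classical_set_scope.
Local Open Scope ring_scope.

(* Key estimate: gamma{V : |P_V z| <= e|z|} <= C e^k.  Rotation invariance makes
   the left-hand side independent of z, so it may be averaged over the integer
   points of a cube of side 1/e; at most a fraction C e^k of these are close to
   the orthogonal complement of a given V.
   Now fix x in X.  Covering the points of X far from x by small sets U_i and
   summing the key estimate over the U_i shows that for almost every V the
   projection separates x from the rest of X: qualitatively from a Hausdorff
   cover and compactness, and with a power rate from Borel-Cantelli over dyadic
   scales for box-counting and Assouad covers.  By Fubini, for almost every V
   this holds at mu-almost every x. *)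

(** The planes to discard depend on [x], and there are uncountably many [x], so the null sets cannot
    simply be united. One works with a set of pairs (x, V) instead; to make it measurable, [y] is
    restricted to a countable dense subset of [X] and constants to natural numbers. The exponents
    come from one balance. For points at distance about r from [x], use balls of radius d = r^(1/a);
    each ball accounts for planes of measure at most a constant times (d/r)^k. With d^(-s) balls the
    total is r^((k-s)/a - k), summable over dyadic r when a < 1 - s/k: the box-counting threshold. A
    homogeneous set needs only about (r/d)^s balls near [x], for a total of r^((1/a-1)(k-s)),
    summable for every a < 1. This local count does not reach points far from [x], which are treated
    by the weaker box-type estimate. Hausdorff covers mix balls of all sizes, so they yield no rate:
    only exact zeros of the projection are excluded, and compactness turns this into continuity. *)

(** * Euclidean norm and orthogonal projection *)

Section EuclideanNorm.
Context {R : realType} {N : nat}.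
Implicit Types (x y u v w : 'rV[R]_N) (V : {vspace 'rV[R]_N}) (a : R).

Lemma dotvDr u v w : dotv w (u + v) = dotv w u + dotv w v.
Proof. by rewrite /dotv -big_split; apply: eq_bigr => i _;
  rewrite mxE mulrDr. Qed.

Lemma dotvDl u v w : dotv (u + v) w = dotv u w + dotv v w.
Proof. by rewrite dotvC dotvDr !(dotvC w). Qed.

Lemma dotvZr a u w : dotv w (a *: u) = a * dotv w u.
Proof. by rewrite /dotv mulr_sumr; apply: eq_bigr => i _;
  rewrite mxE mulrCA. Qed.

Lemma dotvZl a u w : dotv (a *: u) w = a * dotv u w.
Proof. by rewrite dotvC dotvZr dotvC. Qed.

Lemma dotvNr u w : dotv w (- u) = - dotv w u.
Proof. by rewrite -scaleN1r dotvZr mulN1r. Qed.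

Lemma dotvNl u w : dotv (- u) w = - dotv u w.
Proof. by rewrite -scaleN1r dotvZl mulN1r. Qed.

Definition dotv_linE := (dotvDl, dotvDr, dotvNl, dotvNr, dotvZl, dotvZr).

Lemma dotv0 u : dotv 0 u = 0.
Proof. by rewrite -(scale0r u) dotvZl mul0r. Qed.

Lemma dotv_ge0 u : 0 <= dotv u u.
Proof. by apply: sumr_ge0 => i _; rewrite -expr2 sqr_ge0. Qed.

Lemma dotv_gt0 u : u != 0 -> 0 < dotv u u.
Proof.
move=> u0; rewrite lt_neqAle dotv_ge0 andbT eq_sym.
by apply: contra_neq u0 => /dotv_eq0.
Qed.

Lemma dotv_mulmx u v : u *m v^T = (dotv u v)%:M.
Proof.
by rewrite [LHS]mx11_scalar mxE; congr _%:M; apply: eq_bigr => i _; rewrite mxE.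
Qed.

Lemma enorm_ge0 x : 0 <= enorm x.
Proof. exact: sqrtr_ge0. Qed.

Lemma enorm_sqr x : enorm x ^+ 2 = dotv x x.
Proof. by rewrite sqr_sqrtr// dotv_ge0. Qed.

Lemma enorm0 : enorm (0 : 'rV[R]_N) = 0.
Proof. by rewrite /enorm dotv0 sqrtr0. Qed.

Lemma enorm_eq0 x : enorm x = 0 -> x = 0.
Proof. by move=> x0; apply: dotv_eq0; rewrite -enorm_sqr x0 expr0n. Qed.

Lemma enorm_gt0 x : x != 0 -> 0 < enorm x.
Proof. by move=> x0; rewrite sqrtr_gt0 dotv_gt0. Qed.

Lemma enormN x : enorm (- x) = enorm x.
Proof. by rewrite /enorm dotvNl dotvNr opprK. Qed.

Lemma enormB x y : enorm (x - y) = enorm (y - x).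
Proof. by rewrite -enormN opprB. Qed.

Lemma enormZ a x : enorm (a *: x) = `|a| * enorm x.
Proof.
by rewrite /enorm dotvZl dotvZr mulrA -expr2 sqrtrM ?sqr_ge0// sqrtr_sqr.
Qed.

Lemma dotv_le_enorm u v : `|dotv u v| <= enorm u * enorm v.
Proof.
have [->|v0] := eqVneq v 0; first by rewrite enorm0 mulr0 dotvC dotv0 normr0.
have v_gt0 := dotv_gt0 v0.
have := dotv_ge0 (dotv v v *: u - dotv u v *: v).
rewrite !dotv_linE (dotvC v u) => h.
have {}h : 0 <= dotv v v * (dotv u u * dotv v v - dotv u v ^+ 2) by lra.
rewrite pmulr_rge0// subr_ge0 in h.
by rewrite /enorm -sqrtrM ?dotv_ge0// -sqrtr_sqr ler_wsqrtr.
Qed.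

Lemma ler_enormD x y : enorm (x + y) <= enorm x + enorm y.
Proof.
rewrite -(@ler_pXn2r _ 2)// ?nnegrE ?addr_ge0 ?enorm_ge0//.
rewrite sqrrD !enorm_sqr !dotv_linE (dotvC y x).
have := le_trans (ler_norm _) (dotv_le_enorm x y); lra.
Qed.

Lemma ler_enormB y x z : enorm (x - z) <= enorm (x - y) + enorm (y - z).
Proof. by rewrite (le_trans _ (ler_enormD _ _))// addrA subrK. Qed.

Lemma coord_le_enorm x i : `|x 0 i| <= enorm x.
Proof.
rewrite /enorm -sqrtr_sqr ler_wsqrtr// /dotv (bigD1 i)//= -expr2 lerDl.
by apply: sumr_ge0 => j _; rewrite -expr2 sqr_ge0.
Qed.

Lemma enorm_le_coord x a : 0 <= a -> (forall i, `|x 0 i| <= a) ->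
  enorm x <= N%:R * a.
Proof.
move=> a0 xa; rewrite -(@ler_pXn2r _ 2)// ?nnegrE ?mulr_ge0 ?enorm_ge0//.
rewrite enorm_sqr (@le_trans _ _ (\sum_(i < N) a ^+ 2))//.
  by apply: ler_sum => i _; rewrite -expr2 -real_normK ?num_real// lerXn2r//
    nnegrE.
rewrite sumr_const card_ord -[_ *+ N]mulr_natl exprMn ler_wpM2r ?sqr_ge0//.
by rewrite -natrX ler_nat -mulnn; case: N => // n; rewrite leq_pmulr.
Qed.

Lemma orthoproj_uniq V x p : p \in V ->
  (forall v, v \in V -> dotv (x - p) v = 0) -> orthoproj V x = p.
Proof.
move=> Vp xp; apply/eqP; rewrite -subr_eq0; apply/eqP/dotv_eq0.
have Vd : orthoproj V x - p \in V by rewrite rpredB// orthoproj_mem.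
have := xp _ Vd; have := orthoproj_orth x Vd.
by rewrite !dotv_linE => ? ?; lra.
Qed.

Lemma enorm_orthoproj V x : enorm (orthoproj V x) <= enorm x.
Proof.
apply: ler_wsqrtr; have := dotv_ge0 (x - orthoproj V x).
have := orthoproj_orth x (orthoproj_mem V x).
by rewrite !dotv_linE (dotvC _ x) => ? ?; lra.
Qed.

Lemma dotv_orthoproj V x v : v \in V -> dotv (orthoproj V x) v = dotv x v.
Proof.
move=> Vv; have /eqP := orthoproj_orth x Vv.
by rewrite dotvDl dotvNl subr_eq0 => /eqP.
Qed.

End EuclideanNorm.

(** * Integer points near a subspace *)

Lemma modn_inj_near (L a b : nat) : (a <= b + L)%N -> (b <= a + L)%N ->
  (a %% L.+1 = b %% L.+1)%N -> a = b.
Proof.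
wlog ab : a b / (a <= b)%N => [hwlog aL bL ab|_ bL /esym/eqP].
  by case/orP: (leq_total a b) => ?; [|apply/esym]; exact: hwlog.
rewrite eqn_mod_dvd// => dvd; have [/eqP|lt0] := posnP (b - a).
  by rewrite subn_eq0 => ba; apply/eqP; rewrite eqn_leq ab.
by have := dvdn_leq lt0 dvd; rewrite ltnNge leq_subLR bL.
Qed.

Section IntegerPoints.
Context {R : realType} {N : nat}.
Implicit Types V : {vspace 'rV[R]_N}.

(* A basis of V normalised on a set of coordinates that maximises the absolute
   value of the minor; by Cramer's rule its entries are then bounded by 1. *)
Lemma bounded_coordinate_basis (k : nat) V : \dim V = k ->
  exists (f : 'I_k -> 'I_N) (b : 'I_k -> 'rV[R]_N),
    [/\ forall a, b a \in V,
        forall a c, b a 0 (f c) = (a == c)%:R &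
        forall a j, `|b a 0 j| <= 1].
Proof.
move=> <- {k}; set k := \dim V.
pose A : 'M[R]_(N, k) := \matrix_(i, a) ((vbasis V)`_a : 'rV_N) 0 i.
have Afull : row_full A.
  rewrite /row_full -mxrank_tr; apply: inj_row_free => v vA.
  have /basis_free/freeP/(_ (v 0)) v0 := vbasisP V.
  apply/rowP => a; rewrite mxE v0//; apply/rowP => i.
  move/rowP: vA => /(_ i); rewrite !mxE summxE => {2}<-.
  by apply: eq_bigr => c _; rewrite !mxE.
pose D (f : {ffun 'I_k -> 'I_N}) := `|\det (rowsub f A)|.
pose f0 : {ffun 'I_k -> 'I_N} := [ffun a => fullrankfun Afull a].
have D0 : 0 < D f0.
  rewrite normr_gt0 -unitfE -unitmxE.
  by rewrite (eq_rowsub (fullrankfun Afull)) ?fullrowsub_unit// => a;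
    rewrite ffunE.
have [f _ fmax] := @arg_maxP _ R _ f0 xpredT D isT.
have Df : \det (rowsub f A) != 0.
  by rewrite -normr_gt0 (lt_le_trans D0)//; exact: fmax.
have Uf : rowsub f A \in unitmx by rewrite unitmxE unitfE.
pose B := A *m invmx (rowsub f A).
have AE : A = B *m rowsub f A by rewrite mulmxKV.
have BV a : \row_j B j a \in V.
  rewrite (_ : \row_j _ =
      \sum_c invmx (rowsub f A) c a *: (vbasis V)`_c); last first.
    apply/rowP => j; rewrite !mxE summxE; apply: eq_bigr => c _.
    by rewrite !mxE mulrC.
  by apply: rpred_sum => c _; rewrite rpredZ// vbasis_mem// mem_nth//
    size_tuple.
have Bf a c : B (f c) a = (a == c)%:R.
  have : rowsub f B = 1%:M by rewrite -mul_rowsub_mx mulmxV.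
  by move/matrixP/(_ c a); rewrite !mxE eq_sym.
(* Forgets the body of [B]; only these three facts matter from here on. *)
move: B AE BV Bf => B AE BV Bf.
exists f, (fun a => \row_j B j a); split=> [//|a c|a j];
  first by rewrite mxE Bf.
(* Exchanging the row [f a] for the row [j] multiplies the minor by [B j a]; maximality of the minor
   at [f] then bounds this factor by 1. *)
rewrite mxE; pose g := [ffun c => if c == a then j else f c].
have detB : \det (rowsub g B) = B j a.
  rewrite (expand_det_col _ a) (bigD1 a)//= big1 => [|c ca]; last first.
    by rewrite mxE ffunE (negPf ca) Bf eq_sym (negPf ca) mul0r.
  rewrite mxE ffunE eqxx addr0 /cofactor -signr_odd oddD addbb expr0 mul1r.
  rewrite (_ : row' a _ = 1%:M) ?det1 ?mulr1//; apply/matrixP => c d.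
  rewrite !mxE ffunE eq_sym (negPf (neq_lift _ _)) Bf.
  by rewrite (inj_eq (@lift_inj _ _)) eq_sym.
have Dg : D g = `|B j a| * D f by rewrite /D {1}AE -mul_rowsub_mx det_mulmx
  detB normrM.
have : D g <= D f := fmax g isT.
by rewrite Dg ger_pMl ?normr_gt0.
Qed.

(** The coordinates are shifted to 1..n so that, for positive [N], no grid point is zero and each
    can be rescaled to a prescribed norm. *)
Definition grid_point n (g : {ffun 'I_N -> 'I_n}) : 'rV[R]_N :=
  \row_i (g i).+1%:R.

(* The coordinates outside those of [bounded_coordinate_basis], and the
   residues of the remaining ones modulo 2N^2+1, determine the point. *)
Lemma card_grid_point_near_orthogonal (n k : nat) V : \dim V = k ->
  (#|[pred g : {ffun 'I_N -> 'I_n} |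
      (enorm (orthoproj V (grid_point g)) <= N%:R)%R]| <=
   n ^ (N - k) * (2 * N ^ 2).+1 ^ k)%N.
Proof.
move=> dimV; have [f [b [bV bf b1]]] := bounded_coordinate_basis dimV.
set L := (2 * N ^ 2)%N.
have finj : injective f.
  move=> a c fac; apply/eqP; have := bf a c; rewrite -fac bf eqxx.
  by case: (a == c) => // /eqP; rewrite oner_eq0.
pose J := {i : 'I_N | i \notin codom f}.
have cardJ : #|{: J}| = (N - k)%N.
  rewrite card_sig; have := cardC (mem (codom f)).
  rewrite card_codom// !card_ord => /(congr1 (subn^~ k)) /= <-.
  by rewrite addKn; apply: eq_card.
pose h (g : {ffun 'I_N -> 'I_n}) : {ffun J -> 'I_n} * {ffun 'I_k -> 'I_L.+1} :=
  ([ffun i => g (val i)], [ffun a => inord (g (f a) %% L.+1)]).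
apply: (@leq_trans #|{: {ffun J -> 'I_n} * {ffun 'I_k -> 'I_L.+1}}|);
  last first.
  by rewrite card_prod !card_ffun !card_ord cardJ.
apply: (@leq_card_in _ _ h) => g g' /= gV g'V [hJ hk].
have gg'J i : i \notin codom f -> g i = g' i.
  by move=> iJ; have /ffunP/(_ (exist _ i iJ)) := hJ; rewrite !ffunE.
(* As [b a] lies in [V], only the projection of [u] counts; entries bounded by 1 give [b a] norm at
   most N. Two such points differ by at most [L] = 2N^2 along [b a]. *)
have near a u : enorm (orthoproj V u) <= N%:R -> `|dotv u (b a)| <= N%:R ^+ 2.
  move=> uN; rewrite -(dotv_orthoproj _ (bV a)).
  rewrite (le_trans (dotv_le_enorm _ _))// expr2 ler_pM ?enorm_ge0//.
  by rewrite -[leRHS]mulr1 enorm_le_coord.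
have gg'k a : g (f a) = g' (f a).
  have : `|dotv (grid_point g - grid_point g') (b a)| <= L%:R.
    rewrite dotvDl dotvNl (le_trans (ler_normB _ _))//.
    have := near a _ gV; have := near a _ g'V.
    by rewrite /L natrM natrX; lra.
  (* Off the range of [f] the two points agree, and on it [b a] vanishes except at [f a], so this
     product is just the difference of the coordinates at [f a]. *)
  rewrite /dotv (bigD1 (f a))//= big1 ?addr0 => [|i ia]; last first.
    rewrite !mxE; have [/codomP[c ic]|iJ] := boolP (i \in codom f).
      rewrite ic bf; case: eqVneq ic => [<- ic|_ _]; last by rewrite mulr0.
      by rewrite ic eqxx in ia.
    by rewrite gg'J// subrr mul0r.
  rewrite bf eqxx mulr1 !mxE => gL.
  have /ffunP/(_ a) := hk; rewrite !ffunE => /(congr1 val).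
  rewrite /= !inordK ?ltn_mod// => mod_gg'; apply: val_inj => /=.
  move: gL; rewrite ler_norml => /andP[gL g'L].
  apply: modn_inj_near mod_gg'; rewrite -(ler_nat R) natrD; move: gL g'L;
    rewrite ![_.+1%:R]mulrSr; lra.
apply/ffunP => i; have [/codomP[a ->]//|] := boolP (i \in codom f).
exact: gg'J.
Qed.

End IntegerPoints.

(** * Transversality of projections *)

Section Rotations.
Context {R : realType} {N : nat}.
Implicit Types (x u v w z : 'rV[R]_N) (V W : {vspace 'rV[R]_N}) (Q : 'M[R]_N).

(** Both products of block triangular matrices equal the block matrix with identity diagonal blocks
    and off-diagonal blocks [v] and [u]; compare determinants. *)
Lemma det_1_sub_mulmx (u : 'cV[R]_N) (v : 'rV[R]_N) :
  \det (1%:M - u *m v) = 1 - (v *m u) 0 0.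
Proof.
have : block_mx 1%:M 0 u 1%:M *m block_mx 1%:M v 0 (1%:M - u *m v) =
       block_mx 1%:M v 0 1%:M *m block_mx (1%:M - v *m u) 0 u 1%:M.
  rewrite !mulmx_block !(mul1mx, mul0mx, mulmx0, mulmx1, addr0, add0r).
  by rewrite ?[u *m v + _]addrC ?[v *m u + _]addrC !subrK.
move=> /(congr1 determinant); rewrite !det_mulmx !det_lblock !det_ublock.
by rewrite !det1 !mul1r !mulr1 => ->; rewrite det_mx11 !mxE.
Qed.

(** The Householder reflection across the hyperplane orthogonal to [w]. *)
Definition reflection w : 'M[R]_N := 1%:M - (2 / dotv w w) *: (w^T *m w).

Lemma mul_reflection x w :
  x *m reflection w = x - (2 * dotv x w / dotv w w) *: w.
Proof.
rewrite mulmxBr mulmx1 -scalemxAr mulmxA dotv_mulmx mul_scalar_mx scalerA.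
by congr (_ - _ *: _); rewrite mulrAC.
Qed.

Lemma reflection_unitary w : w != 0 -> reflection w *m (reflection w)^T = 1%:M.
Proof.
move=> /dotv_gt0 /lt0r_neq0 w0.
have -> : (reflection w)^T = reflection w.
  by rewrite linearB /= trmx1 linearZ /= trmx_mul trmxK.
apply/row_matrixP => i; rewrite !rowE mulmxA mulmx1 !mul_reflection.
set x := delta_mx _ _; rewrite !dotv_linE divfK// -addrA -opprD -scalerDl.
by rewrite [X in X *: _](_ : _ = 0) ?scale0r ?subr0//; field.
Qed.

Lemma det_reflection w : w != 0 -> \det (reflection w) = -1.
Proof.
move=> /dotv_gt0 /lt0r_neq0 w0.
rewrite /reflection scalemxAl det_1_sub_mulmx -scalemxAr dotv_mulmx !mxE.
by rewrite mulr1n divfK//; lra.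
Qed.

(** The reflection along [z] sends [z] to [- z], and the one along [z + w] sends [- z] to [w]
    because the norms agree. Using two reflections brings the determinant back to 1. *)
Lemma rotation_between z w : enorm z = enorm w -> z != 0 -> z + w != 0 ->
  exists2 Q, rotation Q & z *m Q = w.
Proof.
move=> zw z0 s0; have sE : dotv (z + w) (z + w) = 2 * dotv z (z + w).
  by rewrite !dotv_linE (dotvC w z) -(enorm_sqr w) -zw enorm_sqr; ring.
exists (reflection z *m reflection (z + w)).
  split; last by rewrite det_mulmx !det_reflection// mulrNN mulr1.
  rewrite trmx_mul mulmxA -[_ *m _ *m (_ (z + w))^T]mulmxA.
  by rewrite !reflection_unitary// mulmx1 reflection_unitary.
have /lt0r_neq0 zz := dotv_gt0 z0; have /lt0r_neq0 ss := dotv_gt0 s0.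
rewrite mulmxA [z *m _]mul_reflection mulfK// scaler_nat opprD addNKr.
rewrite mul_reflection dotvNl mulrN mulNr scaleNr opprK -sE divff//.
by rewrite scale1r addKr.
Qed.

Lemma dotv_rotation Q x u : Q *m Q^T = 1%:M ->
  dotv (x *m Q) (u *m Q) = dotv x u.
Proof.
move=> QQ; have := dotv_mulmx (x *m Q) (u *m Q).
rewrite trmx_mul mulmxA -(mulmxA x) QQ mulmx1 dotv_mulmx.
by move=> /matrixP/(_ 0 0); rewrite !mxE.
Qed.

Lemma enorm_rotation Q x : Q *m Q^T = 1%:M -> enorm (x *m Q) = enorm x.
Proof. by move=> QQ; rewrite /enorm dotv_rotation. Qed.

Lemma orthoproj_rotation Q W x : Q *m Q^T = 1%:M ->
  orthoproj (linfun (mulmxr Q) @: W)%VS (x *m Q) = orthoproj W x *m Q.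
Proof.
move=> QQ; apply: orthoproj_uniq => [|_ /memv_imgP[v Wv ->]].
  by apply/memv_imgP; exists (orthoproj W x); rewrite ?orthoproj_mem// lfunE.
by rewrite lfunE /= -mulmxBl dotv_rotation// orthoproj_orth.
Qed.

End Rotations.

(** * Measurability of projections in the vector and the plane *)

Section Measurability.
Context {R : realType} {N : nat} {d : measure_display} {T : measurableType d}.

Lemma measurable_coord i : measurable_fun setT (fun x : Borel R N =>
  (x : 'rV[R]_N) 0 i).
Proof.
apply: (measurability _ (RGenOpens.measurableE R)) => _ [_ [a [b ->]] <-].
rewrite setTI; apply: sub_sigma_algebra.
by have /continuousP := @coord_continuous R 1 N 0 i; apply; exact: itv_open.
Qed.

Lemma measurable_enorm (f : T -> 'rV[R]_N) :
  (forall i, measurable_fun setT (fun t => f t 0 i)) ->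
  measurable_fun setT (fun t => enorm (f t)).
Proof.
move=> mf; apply: (@measurableT_comp _ _ _ _ R R Num.sqrt setT (fun t =>
  dotv (f t) (f t))).
  by apply: continuous_measurable_fun; exact: sqrt_continuous.
by apply: measurable_sum => i; exact: measurable_funM.
Qed.

Context {k : nat} {hkN : (k <= N)%N}.

Lemma measurable_coord_Gr i j :
  measurable_fun setT (fun V : GrBorel R hkN =>
    lin1_mx (orthoproj (\val V)) i j).
Proof.
apply: (measurability _ (RGenOpens.measurableE R)) => _ [_ [a [b ->]] <-].
rewrite setTI; apply: sub_sigma_algebra.
exists ((fun M : 'M[R]_N => M i j) @^-1` `]a, b[) => //.
by have /continuousP := @coord_continuous R N N i j; apply; exact: itv_open.
Qed.

Lemma measurable_orthoproj (f : T -> 'rV[R]_N) (V : T -> GrBorel R hkN) :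
  (forall i, measurable_fun setT (fun t => f t 0 i)) -> measurable_fun setT V ->
  forall i, measurable_fun setT (fun t => orthoproj (\val (V t)) (f t) 0 i).
Proof.
move=> mf mV i; under eq_fun => t do rewrite -mul_rV_lin1 mxE.
apply: measurable_sum => j; apply: measurable_funM => //.
exact: (measurableT_comp (measurable_coord_Gr j i) mV).
Qed.

End Measurability.

(** Integrate the sum of the indicators, which at [t] counts the [i] with [t] in [A i]. This
    converts a count of grid points for each plane into a bound on measures. *)
Lemma sum_probability_le {d} {T : measurableType d} {R : realType}
    (P : probability T R) (I : finType) (A : I -> set T) (K : nat) :
  (forall i, measurable (A i)) ->
  (forall t, (#|[pred i | t \in A i]| <= K)%N) ->
  (\sum_i P (A i) <= K%:R%:E)%E.
Proof.
move=> mA AK; have mI i : measurable_fun setT (fun t => (\1_(A i) t : R)%:E).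
  exact/measurable_EFinP/measurable_indic.
rewrite (eq_bigr (fun i => \int[P]_t (\1_(A i) t)%:E))%E; last first.
  by move=> i _; rewrite integral_indic ?setIT.
rewrite -ge0_integral_sum//.
apply: (@le_trans _ _ (\int[P]_t (cst K%:R%:E) t)%E).
  apply: ge0_le_integral => //.
  - by move=> t _; apply: sume_ge0 => i _; rewrite lee_fin.
  - exact: emeasurable_sum.
  move=> t _; rewrite sumEFin lee_fin.
  apply: (@le_trans _ _ #|[pred i | t \in A i]|%:R); last by rewrite ler_nat.
  rewrite -sum1_card natr_sum [leRHS]big_mkcond /=.
  by apply: ler_sum => i _; rewrite indicE unfold_in /=; case: (t \in A i).
by rewrite integral_cst// -[leRHS]mule1 lee_wpmul2l ?lee_fin// probability_le1.
Qed.

(** * The measure of the planes with a small projection *)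

Section Transversality.
Context {R : realType} {N k : nat} {hkN : (k <= N)%N}.
Context (gamma : probability (GrBorel R hkN) R).
Context (hgamma : rotation_invariant gamma).
Implicit Types (z w : 'rV[R]_N) (V : GrBorel R hkN) (e : R).

Definition small_projection z e : set (GrBorel R hkN) :=
  [set V | enorm (orthoproj (\val V) z) <= e].

Lemma measurable_small_projection z e : measurable (small_projection z e).
Proof.
rewrite -[X in measurable X]setTI; apply: measurable_fun_le => //.
by apply: measurable_enorm; apply: measurable_orthoproj.
Qed.

Lemma Gr_rotate_small_projection (Q : 'M[R]_N) z e : Q *m Q^T = 1%:M ->
  @Gr_rotate R k N hkN Q (small_projection z e) = small_projection (z *m Q) e.
Proof.
move=> QQ; apply/seteqP; split=> [V [W Wz VW]|V Vz].
  by rewrite /small_projection /= VW orthoproj_rotation// enorm_rotation.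
have QQ' : Q^T *m Q = 1%:M by exact: mulmx1C.
(* The inverse rotation of [V]; injectivity of the transpose keeps its dimension equal to [k]. *)
pose W := (linfun (mulmxr Q^T) @: \val V)%VS.
have dimW : \dim W == k.
  rewrite limg_dim_eq ?(eqP (valP V))//; apply/eqP; rewrite -subv0.
  apply/subvP => x; rewrite memv_cap memv0 => /andP[_].
  rewrite memv_ker lfunE /= => /eqP xQ.
  by rewrite -[x]mulmx1 -QQ' mulmxA xQ mul0mx.
have WV : \val V = (linfun (mulmxr Q) @: W)%VS.
  rewrite -limg_comp; apply/esym/eqP.
  rewrite (_ : (_ \o _)%VF = \1%VF) ?lim1g//; apply/lfunP => x.
  by rewrite comp_lfunE !lfunE /= -mulmxA QQ' mulmx1.
exists (exist _ W dimW) => //=.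
by rewrite /small_projection /= -(enorm_rotation _ QQ) -orthoproj_rotation//
  -WV.
Qed.

Lemma small_projection_rotation z w e : enorm z = enorm w -> z != 0 ->
  gamma (small_projection z e) = gamma (small_projection w e).
Proof.
(* Opposite vectors are handled by linearity. Invariance alone would not do: for N = 1 the only
   rotation is the identity. *)
move=> zw z0; have [s0|s0] := eqVneq (z + w) 0.
  congr (gamma _); apply/seteqP; rewrite -(addr0_eq s0).
  by split=> V; rewrite /small_projection /= linearN enormN.
have [Q [QQ detQ] <-] := rotation_between zw z0 s0.
rewrite -Gr_rotate_small_projection// hgamma//.
exact: measurable_small_projection.
Qed.

Let M := (2 * N ^ 2).+1.

(** The n^N sets [A g] all have the measure to be bounded, while each plane lies in at most n^(N-k)
    M^k of them. The threshold relative to the norm is 1/n because grid points have norm at most N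
    n, so it becomes the bound N of the counting lemma. *)
Lemma small_projection_le_nat z n : z != 0 -> (0 < n)%N ->
  (gamma (small_projection z (n%:R^-1 * enorm z)) <= ((M%:R / n%:R) ^+ k)%:E)%E.
Proof.
move=> z0 n0.
have nR0 : 0 < n%:R :> R by rewrite ltr0n.
have N0 : (0 < N)%N.
  by case: N z z0 => // z; case/eqP; apply/rowP => -[].
pose A (g : {ffun 'I_N -> 'I_n}) :=
  small_projection (grid_point g) (n%:R^-1 * enorm (grid_point g)).
have gN (g : {ffun 'I_N -> 'I_n}) : enorm (grid_point g : 'rV[R]_N) <=
  N%:R * n%:R.
  apply: enorm_le_coord => // i.
  by rewrite mxE ger0_norm// ler_nat.
have g0 (g : {ffun 'I_N -> 'I_n}) : (grid_point g : 'rV[R]_N) != 0.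
  apply/eqP => /rowP/(_ (Ordinal N0)); rewrite !mxE.
  by apply/eqP; rewrite pnatr_eq0.
(* Scaling the vector and the threshold together does not change the set, so the grid point is first
   given the norm of [z] and then rotated to it. *)
have Az g : gamma (A g) = gamma (small_projection z (n%:R^-1 * enorm z)).
  pose c := enorm z / enorm (grid_point g : 'rV[R]_N).
  have c0 : 0 < c by rewrite divr_gt0// enorm_gt0.
  have zc : enorm (c *: grid_point g) = enorm z.
    by rewrite enormZ gtr0_norm// divfK// lt0r_neq0// enorm_gt0.
  rewrite -(small_projection_rotation _ zc); last first.
    by rewrite scaler_eq0 negb_or g0 lt0r_neq0.
  congr (gamma _); apply/seteqP; split=> V;
    rewrite /small_projection /= linearZ /= -zc !enormZ gtr0_norm//;
    by rewrite mulrCA ler_pM2l.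
have := @sum_probability_le _ _ _ gamma _ A (n ^ (N - k) * M ^ k).
rewrite (eq_bigr (fun=> gamma (small_projection z (n%:R^-1 * enorm z))))//.
have /fineK <- := fin_num_measure gamma _
  (measurable_small_projection z (n%:R^-1 * enorm z)).
rewrite sumEFin !lee_fin sumr_const card_ffun !card_ord => h.
have {}h : fine (gamma (small_projection z (n%:R^-1 * enorm z))) *+ n ^ N <=
    (n ^ (N - k) * M ^ k)%:R.
  apply: h => [?|V]; first exact: measurable_small_projection.
  apply: leq_trans (card_grid_point_near_orthogonal n (eqP (valP V))).
  apply/subset_leq_card/fintype.subsetP => g; rewrite !unfold_in /= =>
    /set_mem Vg.
  by rewrite (le_trans Vg)// ler_pdivrMl// mulrC gN.
rewrite -(@ler_pM2l _ (n%:R ^+ N)) ?exprn_gt0//.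
rewrite -natrX mulr_natl (le_trans h)// natrM !natrX expr_div_n.
by rewrite -{2}(subnK hkN) exprD -mulrA [n%:R ^+ k * _]mulrCA divff ?mulr1//
  expf_neq0// lt0r_neq0.
Qed.

(* Averaging over the integer grid {1..n}^N with n ~ 1/e, instead of over the
   sphere, reduces the estimate to counting integer points near a subspace. *)
Lemma small_projection_le : (0 < k)%N -> exists2 C : R, 0 < C &
  forall z e, z != 0 -> 0 <= e ->
  (gamma (small_projection z (e * enorm z)) <= (C * e ^+ k)%:E)%E.
Proof.
(* The 2 pays for rounding 1/e down to an integer n: for e at most 1, one has 1/n <= 2e. For larger
   e the bound exceeds 1. *)
move=> k0; pose C : R := (2 * M%:R) ^+ k.
have M1 : 1 <= M%:R :> R by rewrite ler1n.
have C1 : 1 <= C by rewrite exprn_ege1//; lra.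
have le_pos z e : z != 0 -> 0 < e ->
    (gamma (small_projection z (e * enorm z)) <= (C * e ^+ k)%:E)%E.
  move=> z0 e0; have [e1|e1] := leP e 1; last first.
    rewrite (le_trans (probability_le1 _ (measurable_small_projection _ _)))//.
    by rewrite lee_fin -[leLHS]mul1r ler_pM// exprn_ege1// ltW.
  have einv0 : 0 <= e^-1 by rewrite invr_ge0 ltW.
  have /andP[ne en] := truncn_itv einv0; set n := Num.truncn _ in ne en.
  have n0 : (0 < n)%N.
    rewrite -ltnS -(ltr_nat R); apply: le_lt_trans en.
    by rewrite invf_ge1.
  have nR0 : 0 < n%:R :> R by rewrite ltr0n.
  have e_le : e <= n%:R^-1 by rewrite -[e]invrK lef_pV2 ?posrE ?invr_gt0.
  apply: (@le_trans _ _ (gamma (small_projection z (n%:R^-1 * enorm z)))).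
    apply: le_measure; rewrite ?inE; try exact: measurable_small_projection.
    by move=> V /= /le_trans; apply; rewrite ler_wpM2r// enorm_ge0.
  rewrite (le_trans (small_projection_le_nat _ _))// lee_fin /C -exprMn.
  rewrite lerXn2r ?nnegrE ?divr_ge0 ?mulr_ge0// ?(ltW e0)//.
  rewrite ler_pdivrMr// [leRHS](_ : _ = M%:R * (2 * (e * n%:R))); last by ring.
  rewrite -[leLHS]mulr1 ler_wpM2l//.
  have : 1 <= e * n.+1%:R by rewrite mulrC -ler_pdivrMr// mul1r ltW.
  have : e * 1 <= e * n%:R by rewrite ler_pM2l// ler1n.
  by rewrite mulrSr mulrDr; lra.
exists C => [|z e z0]; first by rewrite (lt_le_trans _ C1).
rewrite le_eqVlt => /orP[/eqP<-|]; last exact: le_pos.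
rewrite expr0n gtn_eqF// mulr0 mul0r; apply/lee_addgt0Pr => d d0; rewrite add0e.
(* The case e = 0 follows by monotonicity from the positive [e1]: since it is at most 1 and k > 0, C
   e1^k <= C e1 <= d. *)
pose e1 := Num.min 1 (d / C); have C0 : 0 < C by rewrite (lt_le_trans _ C1).
have e10 : 0 < e1 by rewrite lt_min ltr01 divr_gt0.
apply: (@le_trans _ _ (gamma (small_projection z (e1 * enorm z)))).
  apply: le_measure; rewrite ?inE; try exact: measurable_small_projection.
  by move=> V /= /le_trans; apply; rewrite mulr_ge0 ?enorm_ge0// ltW.
rewrite (le_trans (le_pos _ _ z0 e10))// lee_fin mulrC -ler_pdivlMr//.
rewrite (@le_trans _ _ e1) ?ge_min ?lexx ?orbT//.
by rewrite -[leRHS]expr1 ler_wiXn2l// ?(ltW e10)// ge_min lexx.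
Qed.

End Transversality.

(** * Almost every projection at almost every point *)

(** The products built from x-sections and from y-sections coincide, so [E] is null for both; the
    nonnegative integrand in [y] then vanishes almost everywhere. *)
Lemma ae_ysection_null {d1 d2} {T1 : measurableType d1} {T2 : measurableType d2}
    {R : realType} (m1 : {sigma_finite_measure set T1 -> \bar R})
    (m2 : {sigma_finite_measure set T2 -> \bar R}) (E : set (T1 * T2)) :
  measurable E -> (forall x, m2 (xsection E x) = 0%E) ->
  {ae m2, forall y, m1 (ysection E y) = 0%E}.
Proof.
move=> mE E0; have : (m1 \x^ m2)%E E = 0%E.
  rewrite -(@product_measure_unique _ _ _ _ _ m1 m2 (m1 \x^ m2)%E)//.
    by rewrite [LHS]integral0_eq// => x _; exact: E0.
  by move=> A B mA mB; exact: product_measure2E.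
have mf : measurable_fun setT (m1 \o ysection E) by exact:
  measurable_fun_ysection.
rewrite (_ : (m1 \x^ m2)%E E = \int[m2]_y `|(m1 \o ysection E) y|)%E;
  last first.
  by apply: eq_integral => y _; rewrite gee0_abs.
by move=> /(ae_eq_integral_abs m2 measurableT mf); apply: filterS => y; exact.
Qed.

(** Plays the part of right continuity of the power function: a gap between values becomes a gap
    between arguments. *)
Lemma powR_addr {R : realType} (a t e : R) : 0 < a -> 0 <= t -> 0 < e ->
  exists2 t', t < t' & t' `^ a = t `^ a + e.
Proof.
move=> a0 t0 e0; exists ((t `^ a + e) `^ a^-1).
  rewrite -[ltLHS](@powRr1)// -(divff (lt0r_neq0 a0)) powRrM.
  by rewrite gt0_ltr_powR ?invr_gt0// ?nnegrE ?addr_ge0 ?powR_ge0// ?ltW//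
    ltrDl.
by rewrite -powRrM mulVf ?lt0r_neq0// powRr1// addr_ge0 ?powR_ge0// ltW.
Qed.

Section DenseSequence.
Context {R : realType} {N : nat}.

Lemma rat_vector_near (x : 'rV[R]_N) (e : R) : 0 < e ->
  exists q : 'rV[rat]_N, enorm (x - map_mx ratr q) < e.
Proof.
move=> e0; pose h := e / N.+1%:R; have h0 : 0 < h by rewrite divr_gt0.
have /choice[q qP] i : exists q : rat, `|x 0 i - ratr q| <= h.
  have /rat_in_itvoo[q] : x 0 i - h < x 0 i + h by lra.
  by rewrite in_itv /= => /andP[? ?]; exists q; rewrite ler_norml; lra.
exists (\row_i q i); apply: le_lt_trans (enorm_le_coord (ltW h0) _) _.
  by move=> i; rewrite !mxE.
by rewrite /h mulrA ltr_pdivrMr// mulrC ltr_pM2l// ltr_nat.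
Qed.

(** Rational points need not lie in [X]; instead, every ball of radius 1/(m+1) about a rational
    point that meets [X] contributes one point of [X], with [x0] as the default. *)
Lemma dense_sequence (X : set 'rV[R]_N) : X !=set0 ->
  exists D : nat -> 'rV[R]_N, (forall n, X (D n)) /\
    forall y, X y -> forall e, 0 < e -> exists n, enorm (y - D n) < e.
Proof.
move=> [x0 Xx0]; pose C := ('rV[rat]_N * nat)%type.
pose Q (c : C) p := X p /\ enorm (p - map_mx ratr c.1) < c.2.+1%:R^-1.
pose D n := if unpickle n is Some c then
  (if pselect (exists p, Q c p) is left h then projT1 (cid h) else x0) else x0.
exists D; split=> [n|y Xy e e0].
  rewrite /D; case: unpickle => // c; case: pselect => // h.
  by have [] := projT2 (cid h).
have e20 : 0 < e / 2 by rewrite divr_gt0.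
pose m := Num.truncn (e / 2)^-1.
have me : m.+1%:R^-1 < e / 2.
  by rewrite invf_plt ?posrE// truncnS_gt.
have [q yq] := @rat_vector_near y m.+1%:R^-1 ltac:(by []).
exists (pickle ((q, m) : C)); rewrite /D pickleK; case: pselect => [h|];
  last first.
  by case; exists y.
have [_ /= pq] := projT2 (cid h).
apply: le_lt_trans (ler_enormB (map_mx ratr q) _ _) _.
rewrite [X in _ + X]enormB; have := lt_trans yq me; have := lt_trans pq me.
by lra.
Qed.

End DenseSequence.

Section NearInverse.
Context {R : realType} {N : nat}.
Implicit Types (x y : 'rV[R]_N) (V : {vspace 'rV[R]_N}) (X : set 'rV[R]_N).

(* Imposed on x ranging over XV, this makes the inverse of the projection
   continuous if it holds with a = 1 for arbitrarily small e, and pointwise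
   a-Hoelder if it holds with e = 0. *)
Definition near_inverse X (e a : R) V x := exists m : nat, forall y, X y ->
  enorm (x - y) <= e + m%:R * enorm (orthoproj V (x - y)) `^ a.

(** Rewrites the condition with countable quantifiers only, which gives measurability. The same [m]
    works in both directions, as both sides of the inequality are continuous in [y]. *)
Lemma near_inverse_dense X (D : nat -> 'rV[R]_N) (e a : R) V x : 0 < a ->
  (forall n, X (D n)) ->
  (forall y, X y -> forall d, 0 < d -> exists n, enorm (y - D n) < d) ->
  near_inverse X e a V x <->
  exists m : nat, forall n,
    enorm (x - D n) <= e + m%:R * enorm (orthoproj V (x - D n)) `^ a.
Proof.
move=> a0 XD denseD; split=> -[m xm]; exists m; first by move=> n; exact: xm.
move=> y Xy.
rewrite leNgt; apply/negP; set t := enorm (orthoproj V _) => ylt.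
(* Half of the violation [g] absorbs the move from [y] to [D n] on the left, the other half the
   growth of the power term on the right; [m.+1] keeps the denominator nonzero. *)
pose g := enorm (x - y) - (e + m%:R * t `^ a).
have g0 : 0 < g by rewrite subr_gt0.
have gm0 : 0 < g / (2 * m.+1%:R) by rewrite divr_gt0.
have [t' tt' t'E] := powR_addr a0 (enorm_ge0 _ : 0 <= t) gm0.
have [|n yn] := denseD y Xy (Num.min (g / 2) (t' - t)).
  by rewrite lt_min divr_gt0//= subr_gt0.
move: yn; rewrite lt_min => /andP[yn1 yn2].
have le1 : enorm (orthoproj V (x - D n)) `^ a <= t' `^ a.
  rewrite ge0_ler_powR ?(ltW a0) ?nnegrE ?enorm_ge0//.
    by rewrite (le_trans (enorm_ge0 _ : 0 <= t))// ltW.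
  rewrite -[x](subrK y) -addrA linearD /= (le_trans (ler_enormD _ _))// -/t.
  by have := enorm_orthoproj V (y - D n); lra.
have := xm n; have := ler_enormB (D n) x y; rewrite (enormB (D n) y).
have : m%:R * enorm (orthoproj V (x - D n)) `^ a <= m%:R * t `^ a + g / 2.
  rewrite (le_trans (ler_wpM2l _ le1))// t'E mulrDr lerD2l.
  rewrite invfM [leLHS](_ : _ = g / 2 * (m%:R / m.+1%:R)); last by ring.
  rewrite -[leRHS]mulr1 ler_wpM2l ?divr_ge0 ?(ltW g0)//.
  by rewrite ler_pdivrMr// mul1r ler_nat.
by rewrite /g in yn1 *; lra.
Qed.

Context {k : nat} {hkN : (k <= N)%N}.
Context (gamma : probability (GrBorel R hkN) R).
Context (mu : {finite_measure set (Borel R N) -> \bar R}).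

Lemma closed_Borel X : closed X -> measurable (X : set (Borel R N)).
Proof.
move=> cX; rewrite -(setCK X); apply: measurableC.
by apply: sub_sigma_algebra; exact: closed_openC.
Qed.

(** All indices [n] share one exceptional set [E], so that a single [XV] serves every precision and
    every exponent. *)
Lemma ae_full_near_inverse X (e a : nat -> R) : compact X -> mu (~` X) = 0%E ->
  (forall n, 0 < a n) ->
  (forall n x, X x ->
    {ae gamma, forall W, near_inverse X (e n) (a n) (\val W) x}) ->
  {ae gamma, forall W, exists2 XV : set 'rV[R]_N, full_borel_subset mu X XV &
    forall n x, XV x -> near_inverse X (e n) (a n) (\val W) x}.
Proof.
move=> cX muX a0 near_ae.
have [X0|/set0P Xne] := eqVneq X set0.
  apply: aeW => V; exists set0 => //; split => //.
  by rewrite -X0.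
have mX : measurable (X : set (Borel R N)).
  by apply: closed_Borel; apply: compact_closed => //; exact: norm_hausdorff.
have [D [XD denseD]] := dense_sequence Xne.
have nearP n V x := near_inverse_dense (e n) V x (a0 n) XD denseD.
pose S n m j : set (Borel R N * GrBorel R hkN) := [set p |
  enorm (p.1 - D j : 'rV[R]_N) <=
    e n + m%:R * enorm (orthoproj (\val p.2) (p.1 - D j)) `^ a n].
pose G := \bigcap_n \bigcup_m \bigcap_j S n m j.
pose E : set (Borel R N * GrBorel R hkN) :=
  ((X : set (Borel R N)) `*` setT) `\` G.
have mS n m j : measurable (S n m j).
  have m1 i : measurable_fun setT
      (fun p : Borel R N * GrBorel R hkN => (p.1 - D j : 'rV[R]_N) 0 i).
    under eq_fun do rewrite mxE.
    apply: measurable_funD => //.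
    exact: (measurableT_comp (measurable_coord i) measurable_fst).
  rewrite -[X in measurable X]setTI; apply: measurable_fun_le => //.
    exact: (measurable_enorm m1).
  apply: measurable_funD => //; apply: measurable_funM => //.
  apply: (@measurableT_comp _ _ _ _ R R (fun t => t `^ a n)) => //.
  exact: (measurable_enorm (measurable_orthoproj m1 measurable_snd)).
have mE : measurable E.
  apply: measurableD; first exact: measurableX.
  apply: bigcapT_measurable => n; apply: bigcupT_measurable => m.
  exact: bigcapT_measurable.
have GP x (V : GrBorel R hkN) :
    G (x, V) <-> forall n, near_inverse X (e n) (a n) (\val V) x.
  split=> [Gx n|near n _]; last first.
    by have /nearP[m xm] := near n; exists m => // j _; exact: xm.
  by have [m _ xm] := Gx n I; apply/nearP; exists m => j; exact: (xm j).
have E0 x : gamma (xsection E x) = 0%E.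
  have [Xx|nXx] := pselect (X x); last first.
    rewrite (_ : xsection E x = set0) ?measure0//.
    by apply/seteqP; split=> // V; rewrite /xsection /= inE => -[[]].
  apply/negligibleP; first exact: measurable_xsection.
  have := ae_foralln (fun n => near_ae n x Xx); apply: negligibleS => V.
  by rewrite /xsection /= inE => -[_ nG] /GP.
have := ae_ysection_null mu mE E0; apply: filterS => V EV0.
exists (X `\` ysection E V); last first.
  move=> n x [Xx nE]; apply/GP: n; apply: contrapT => nG; apply: nE.
  by rewrite /ysection /= inE.
have mEV := measurable_ysection V mE.
split; [exact: measurableD|exact: subDsetl|].
rewrite setDE setCI setCK; apply/negligibleP.
  by apply: measurableU => //; exact: measurableC.
by apply: negligibleU; apply/negligibleP => //; exact: measurableC.
Qed.

End NearInverse.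

(** * Almost every projection at a fixed point *)

Section Compactness.
Context {R : realType} {N : nat}.
Implicit Types (x y z : 'rV[R]_N) (V : {vspace 'rV[R]_N}) (X : set 'rV[R]_N).

Lemma lipschitz_continuous (f : 'rV[R]_N -> R) (c : R) :
  (forall y z, `|f y - f z| <= c * enorm (y - z)) -> continuous f.
Proof.
move=> fc y s /= /(nbhs_ballP (f y))[e /= e0 es].
have [K K0 fK] : exists2 K, 0 < K & forall z, `|f y - f z| <= K * enorm (y - z).
  exists (`|c| + 1); first by rewrite ltr_wpDl.
  move=> z; rewrite (le_trans (fc _ _))// ler_wpM2r ?enorm_ge0//.
  by rewrite (le_trans (ler_norm _))// lerDl.
pose h := e / (K * N.+1%:R).
have h0 : 0 < h by rewrite divr_gt0// mulr_gt0.
apply/nbhs_ballP; exists h => //= z [_ yz]; apply: es; rewrite /ball /=.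
rewrite (le_lt_trans (fK z))//; apply: (@le_lt_trans _ _ (K * (N%:R * h))).
  rewrite ler_wpM2l ?(ltW K0)// enorm_le_coord ?(ltW h0)// => i.
  by rewrite !mxE ltW//; exact: yz.
rewrite [ltLHS](_ : _ = e * (N%:R / N.+1%:R)); last first.
  by rewrite /h; field; rewrite nat1r pnatr_eq0 lt0r_neq0.
by rewrite gtr_pMr// ltr_pdivrMr// mul1r ltr_nat.
Qed.

Lemma compact_enorm_bounded X x : compact X ->
  exists2 B, 0 < B & forall y, X y -> enorm (x - y) <= B.
Proof.
move=> cX; have [X0|/set0P Xne] := eqVneq X set0.
  by exists 1 => // y; rewrite X0.
have [|y _ ymax] := compact_EVT_max (f := fun y => enorm (x - y)) Xne cX.
  apply/continuous_subspaceT/(lipschitz_continuous (c := 1)) => y z.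
  have := ler_enormB y x z; have := ler_enormB z x y.
  by rewrite (enormB z y) mul1r ler_norml; lra.
exists (enorm (x - y) + 1); first by rewrite ltr_wpDl ?enorm_ge0.
by move=> z Xz; rewrite ler_wpDr// ymax// inE.
Qed.

(** The term [Num.max 0 (e - enorm (x - y))] in [f] makes it positive also near [x], hence bounded
    below on [X] by a positive minimum; farther than [e] from [x] it vanishes and leaves the
    projected distance. *)
Lemma near_inverse_compact X V x e : 0 <= e -> compact X -> X x ->
  (forall y, X y -> e <= enorm (x - y) -> orthoproj V (x - y) <> 0) ->
  near_inverse X e 1 V x.
Proof.
move=> e0 cX Xx XV.
pose f y := enorm (orthoproj V (x - y)) + Num.max 0 (e - enorm (x - y)).
have cf : continuous f.
  apply: (lipschitz_continuous (c := 2)) => y z.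
  have h1 : `|enorm (orthoproj V (x - y)) - enorm (orthoproj V (x - z))| <=
      enorm (y - z).
    have yz := enorm_orthoproj V (y - z).
    have E : orthoproj V (x - z) = orthoproj V (x - y) + orthoproj V (y - z).
      by rewrite -linearD addrA subrK.
    have := ler_enormD (orthoproj V (x - y)) (orthoproj V (y - z)).
    have := ler_enormD (orthoproj V (x - z)) (- orthoproj V (y - z)).
    by rewrite enormN E addrK ler_norml; lra.
  have h2 : `|Num.max 0 (e - enorm (x - y)) - Num.max 0 (e - enorm (x - z))| <=
      enorm (y - z).
    have := ler_enormB y x z; have := ler_enormB z x y; rewrite (enormB z y).
    have := enorm_ge0 (y - z).
    by rewrite ler_norml /Num.max; do 2!case: ifPn; rewrite -?leNgt; lra.
  rewrite /f opprD addrACA (le_trans (ler_normD _ _))//; lra.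
have [|c Xc cmin] := compact_EVT_min (f := f) _ cX (continuous_subspaceT cf).
  by exists x.
have fc0 : 0 < f c.
  have := enorm_ge0 (orthoproj V (x - c)); rewrite /f le_eqVlt =>
    /orP[/eqP P0|]; last first.
    by move=> h; rewrite ltr_wpDr// le_max lexx.
  rewrite -P0 add0r lt_max ltxx /= subr_gt0 ltNge; apply/negP => ec.
  by move: Xc; rewrite inE => Xc; apply: (XV c Xc ec); apply: enorm_eq0.
have [B B0 XB] := compact_enorm_bounded x cX.
exists (Num.truncn (B / f c)).+1 => y Xy; rewrite powRr1 ?enorm_ge0//.
have [xye|exy] := leP (enorm (x - y)) e.
  by rewrite (le_trans xye)// lerDl mulr_ge0// enorm_ge0.
have fy : f c <= enorm (orthoproj V (x - y)).
  have := cmin y; rewrite inE => /(_ Xy); rewrite {2}/f.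
  by rewrite max_l ?addr0// subr_le0 ltW.
rewrite (le_trans (XB _ Xy))// ler_wpDl//.
apply: (@le_trans _ _ ((Num.truncn (B / f c)).+1%:R * f c)).
  by rewrite -ler_pdivrMr// ltW// truncnS_gt.
by rewrite ler_wpM2l.
Qed.

End Compactness.

(** * Hausdorff covers *)

Section HausdorffCovers.
Context {R : realType} {N k : nat} {hkN : (k <= N)%N} (hk : (0 < k)%N).
Context (gamma : probability (GrBorel R hkN) R) (C : R) (C0 : 0 < C).
Context (transversal : forall (z : 'rV[R]_N) (e : R), z != 0 -> 0 <= e ->
  (gamma (@small_projection R N k hkN z (e * enorm z)) <= (C * e ^+ k)%:E)%E).
Implicit Types (x y z : 'rV[R]_N) (X U : set 'rV[R]_N).

(** A single [z] in [U] at distance at least [r] from [x] represents all of [U]: replacing [y] by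
    [z] changes the projection by at most [d]. Without such a [z] the empty set will do. *)
Lemma small_projection_set_le x U (r d e : R) : 0 < r -> 0 <= d -> 0 <= e ->
  (forall y z, U y -> U z -> enorm (y - z) <= d) ->
  exists B : set (GrBorel R hkN), [/\ measurable B,
    (gamma B <= (C * ((e + d) / r) ^+ k)%:E)%E &
    forall (W : GrBorel R hkN) y, U y -> r <= enorm (x - y) ->
      enorm (orthoproj (\val W) (x - y)) <= e -> B W].
Proof.
move=> r0 d0 e0 Ud.
have [[z [Uz rz]]|noz] := pselect (exists z, U z /\ r <= enorm (x - z));
  last first.
  exists set0; split; [exact: measurable0| |by move=> W y Uy ry; case: noz;
    exists y].
  by rewrite measure0 lee_fin mulr_ge0 ?(ltW C0)// exprn_ge0//
    divr_ge0 ?addr_ge0// ltW.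
have xz0 : 0 < enorm (x - z) by exact: lt_le_trans rz.
exists (small_projection (x - z) ((e + d) / enorm (x - z) * enorm (x - z))).
split; [exact: measurable_small_projection| |]; last first.
  move=> W y Uy ry We; rewrite /small_projection /= divfK ?lt0r_neq0//.
  have -> : x - z = (x - y) + (y - z) by rewrite addrA subrK.
  rewrite linearD (le_trans (ler_enormD _ _))// lerD//.
  by rewrite (le_trans (enorm_orthoproj _ _))// Ud.
rewrite (le_trans (transversal _ _))//.
- by apply: contraTneq xz0 => ->; rewrite enorm0 ltxx.
- by rewrite divr_ge0 ?addr_ge0// ltW.
rewrite lee_fin ler_wpM2l ?(ltW C0)// lerXn2r ?nnegrE ?divr_ge0 ?addr_ge0//.
- exact: ltW.
- exact: ltW.
- by rewrite ler_wpM2l ?addr_ge0// lef_pV2.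
Qed.

Lemma negligible_outer (A : set (GrBorel R hkN)) :
  (forall e : R, 0 < e -> exists B, [/\ measurable B, A `<=` B & (gamma B <=
    e%:E)%E]) ->
  gamma.-negligible A.
Proof.
move=> AB; have /choice[B BP] n := AB n.+1%:R^-1 ltac:(by rewrite invr_gt0).
have mB : measurable (\bigcap_n B n).
  by apply: bigcapT_measurable => n; case: (BP n).
exists (\bigcap_n B n); split=> //; last first.
  by move=> V AV n _; have [_ + _] := BP n; exact.
apply/eqP; rewrite eq_le measure_ge0 andbT; apply/lee_addgt0Pr => e e0.
rewrite add0e; pose n := Num.truncn e^-1; have [mBn _ Bn] := BP n.
apply: (@le_trans _ _ (gamma (B n))).
  by apply: le_measure; rewrite ?inE//; exact: bigcap_inf.
rewrite (le_trans Bn)// lee_fin invf_ple ?posrE//.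
by rewrite ltW// truncnS_gt.
Qed.

(** The content at scale 1 is enough: diameters at most 1 already let a k-th power be bounded by a
    t-th power when t <= k. *)
Lemma hausdorff_dim_lt_cover X (s : R) : (hausdorff_dim X < s%:E)%E ->
  exists2 t : R, 0 < t < s & forall e : R, 0 < e ->
    exists U : nat -> set 'rV[R]_N,
      [/\ X `<=` \bigcup_i U i, forall i, (ediam (U i) <= 1)%E &
          (\sum_(0 <= i <oo) ediam (U i) `^ t < e%:E)%E].
Proof.
move=> /ereal_inf_lt[_ [t /= [t0 Ht] <-]]; rewrite lte_fin => ts.
exists t => [|e e0]; first by rewrite t0.
have : (hausdorff_content t 1 X < e%:E)%E.
  have : (hausdorff_content t 1 X <= 0)%E.
    by rewrite -Ht; apply: ereal_sup_ubound; exists 1; rewrite //= ltr01.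
  by move=> /le_lt_trans; apply; rewrite lte_fin.
by move=> /ereal_inf_lt[_ [U [XU U1] <-] ?]; exists U.
Qed.

Lemma ediam_ge0 U : (0 <= ediam U)%E.
Proof. by apply: ereal_sup_ubound; left. Qed.

Lemma le_ediam U y z : U y -> U z -> ((enorm (y - z))%:E <= ediam U)%E.
Proof. by move=> Uy Uz; apply: ereal_sup_ubound; right; exists y => //;
  exists z. Qed.

(** By [near_inverse_compact] only planes killing some [x - y] of norm at least [r] are bad, so
    [small_projection_set_le] applies with threshold 0. The bad planes have measure at most C / r^k
    times the sum of the t-th powers of the diameters. *)
Lemma ae_near_inverse_hausdorff X x (r : R) : compact X -> X x -> 0 < r ->
  (hausdorff_dim X < k%:R%:E)%E ->
  {ae gamma, forall W, near_inverse X r 1 (\val W) x}.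
Proof.
move=> cX Xx r0 /hausdorff_dim_lt_cover[t /andP[t0 tk] cover].
apply: (@negligibleS _ _ _ gamma
  [set W | exists y, [/\ X y, r <=
    enorm (x - y) & orthoproj (\val W) (x - y) = 0]]).
  move=> W /=; apply: contra_notP => noy.
  apply: near_inverse_compact => //; first exact: ltW.
  by move=> y Xy ry P0; apply: noy; exists y.
apply: negligible_outer => e e0; pose c := C / r ^+ k.
have c0 : 0 < c by rewrite divr_gt0// exprn_gt0.
have [U [XU U1 Ue]] := cover (e / c) ltac:(by rewrite divr_gt0).
have Ufin i : ediam (U i) \is a fin_num.
  by rewrite ge0_fin_numE ?ediam_ge0// (le_lt_trans (U1 i))// ltry.
pose d i := fine (ediam (U i)).
have dE i : ediam (U i) = (d i)%:E by rewrite fineK.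
have d0 i : 0 <= d i by rewrite fine_ge0// ediam_ge0.
have d1 i : d i <= 1 by rewrite -lee_fin -dE.
have Ud i y z : U i y -> U i z -> enorm (y - z) <= d i.
  by move=> Uy Uz; rewrite -lee_fin -dE le_ediam.
have /choice[B BP] := fun i =>
  small_projection_set_le x r0 (d0 i) (lexx 0) (@Ud i).
have mB i : measurable (B i) by case: (BP i).
exists (\bigcup_i B i); split; first exact: bigcupT_measurable.
  move=> W [y [Xy ry P0]]; have [i _ Uy] := XU y Xy; exists i => //.
  by case: (BP i) => _ _ /(_ W y Uy ry); apply; rewrite P0 enorm0.
apply: (le_trans (measure_sigma_subadditive _ mB (bigcupT_measurable _ mB) _))
  => //.
apply: (@le_trans _ _ (\sum_(0 <= i <oo) (c%:E * ediam (U i) `^ t))%E).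
  apply: lee_nneseries => [i _ _|i _]; first exact: measure_ge0.
  case: (BP i) => _ /le_trans + _; apply.
  rewrite dE poweR_EFin -EFinM lee_fin add0r expr_div_n mulrCA mulrC.
  rewrite ler_wpM2l ?(ltW c0)//.
  have [->|di0] := eqVneq (d i) 0; first by rewrite expr0n gtn_eqF// powR_ge0.
  rewrite -powR_mulrn// ger_powR ?(ltW tk)//.
  by rewrite lt_neqAle eq_sym di0 d0 d1.
rewrite nneseriesZl//; last by move=> i _; exact: poweR_ge0.
by rewrite muleC -lee_pdivlMr// ltW.
Qed.

End HausdorffCovers.

Lemma nneseries_geometric_lty {R : realType} (u : nat -> \bar R) (a q : R) :
  0 <= a -> 0 <= q < 1 -> (forall n, (0 <= u n <= (a * q ^+ n)%:E)%E) ->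
  (\sum_(0 <= n <oo) u n < +oo)%E.
Proof.
move=> a0 /andP[q0 q1] uaq.
apply: (@le_lt_trans _ _ (a / (1 - q))%:E); last exact: ltry.
apply: lime_le.
  by apply: is_cvg_nneseries => n _ _; case/andP: (uaq n).
apply: nearW => n; apply: (@le_trans _ _ (\sum_(0 <= i < n) (a * q ^+ i)%:E)%E).
  by apply: lee_sum => i _; case/andP: (uaq i).
have := geometric_seriesE a (negbT (lt_eqF q1)).
move=> /(congr1 (fun f => f n)) /=; rewrite /series /= => E.
rewrite sumEFin E lee_fin ler_wpM2r ?invr_ge0 ?subr_ge0 ?(ltW q1)//.
by rewrite -[leRHS]mulr1 ler_wpM2l// lerBlDr lerDl exprn_ge0.
Qed.

Lemma ae_imply {d} {T : measurableType d} {R : realType}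
    (m : {measure set T -> \bar R}) (P Q : T -> Prop) :
  (forall t, P t -> Q t) -> {ae m, forall t, P t} -> {ae m, forall t, Q t}.
Proof. by move=> PQ; apply: negligibleS => t; apply: contra_not; exact: PQ. Qed.

Lemma ae_and {d} {T : measurableType d} {R : realType}
    (m : {measure set T -> \bar R}) (P Q : T -> Prop) :
  {ae m, forall t, P t} -> {ae m, forall t, Q t} -> {ae m, forall t,
    P t /\ Q t}.
Proof.
move=> mP mQ; apply: negligibleS (negligibleU mP mQ) => t /= /not_andP[]; tauto.
Qed.

(** * Borel-Cantelli over dyadic scales *)

Section Scales.
Context {R : realType} {N k : nat} {hkN : (k <= N)%N} (hk : (0 < k)%N).
Context (gamma : probability (GrBorel R hkN) R) (C : R) (C0 : 0 < C).
Context (transversal : forall (z : 'rV[R]_N) (e : R), z != 0 -> 0 <= e ->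
  (gamma (@small_projection R N k hkN z (e * enorm z)) <= (C * e ^+ k)%:E)%E).
Implicit Types (x y z : 'rV[R]_N) (X U : set 'rV[R]_N).

Let r n : R := 2^-1 ^+ n.

Definition ball_cover X (K : nat) (d : R) := exists c : nat -> 'rV[R]_N,
  X `<=` \bigcup_(j < K) eball (c j) d.

Lemma covering_number_lt X (d B : R) : (covering_number X d < B%:E)%E ->
  exists2 K, K%:R < B & ball_cover X K d.
Proof.
move=> /ereal_inf_lt[_ [K /= [c Xc] <-]]; rewrite lte_fin => KB.
(* Indices from [K] on get the default centre 0, which the cover never uses. *)
exists K => //; exists (fun j => if insub j is Some i then c i else 0) => y Xy.
by have [i _ yi] := Xc y Xy; exists i => /=; rewrite ?valK.
Qed.

(** The 3 is the threshold [d] plus the bound 2d on the diameter of a ball. *)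
Lemma ball_cover_small_projection X x K (rho d : R) : 0 < rho -> 0 < d ->
  ball_cover X K d ->
  exists B : set (GrBorel R hkN), [/\ measurable B,
    (gamma B <= (K%:R * (C * (3 * d / rho) ^+ k))%:E)%E &
    forall (W : GrBorel R hkN) y, X y -> rho <= enorm (x - y) ->
      enorm (orthoproj (\val W) (x - y)) <= d -> B W].
Proof.
move=> rho0 d0 [c Xc].
have ballP j y z : eball (c j) d y -> eball (c j) d z -> enorm (y - z) <= 2 * d.
  rewrite /eball /= => cy cz; have := ler_enormB (c j) y z;
    rewrite (enormB y (c j)).
  by lra.
have /choice[B BP] := fun j => small_projection_set_le C0 transversal x rho0
  (mulr_ge0 (ler0n R 2) (ltW d0)) (ltW d0) (@ballP j).
have mB j : measurable (B j) by case: (BP j).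
exists (\big[setU/set0]_(j < K) B j); split; first exact: bigsetU_measurable.
  rewrite (le_trans (@content_subadditive _ _ _ gamma _ B K _ _ _))//.
    exact: bigsetU_measurable.
  rewrite mulr_natl -[K in leRHS]card_ord -sumr_const.
  rewrite -sumEFin; apply: lee_sum => j _; case: (BP j) => _ + _.
  by rewrite (_ : d + 2 * d = 3 * d)//; ring.
move=> W y Xy rhoy Wy; have [j jK yj] := Xc y Xy.
by rewrite -bigcup_mkord; exists j => //; case: (BP j) =>
  _ _ /(_ W y yj rhoy Wy).
Qed.

Lemma scale_gt0 n : 0 < r n.
Proof. by rewrite exprn_gt0// invr_gt0. Qed.

Lemma scale_le1 n : r n <= 1.
Proof. by rewrite exprn_ile1// ?invr_ge0// invf_le1// ler1n. Qed.

Lemma ler_scale m n : (m <= n)%N -> r n <= r m.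
Proof. by move=> mn; rewrite ler_wiXn2l// ?invr_ge0// invf_le1// ler1n. Qed.

Lemma scale_lt (t : R) : 0 < t -> exists n, r n < t.
Proof.
move=> t0; exists (Num.truncn t^-1); rewrite /r exprVn.
rewrite invf_plt ?posrE ?exprn_gt0//; apply: lt_le_trans (truncnS_gt _) _.
by rewrite -natrX ler_nat ltn_expl.
Qed.

Lemma dyadic_scale (t : R) n0 : 0 < t -> t <= r n0 ->
  exists2 n, (n0 <= n)%N & r n / 2 <= t <= r n.
Proof.
move=> t0 tn0; have exn : exists n, r n / 2 <= t.
  have [n nt] := scale_lt t0; exists n.
  by rewrite (le_trans _ (ltW nt))// ler_pdivrMr//
    ler_peMr ?(ltW (scale_gt0 _))// ler1n.
case: (ex_minnP exn) => n nt nmin; have [nn0|n0n] := leqP n n0.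
  exists n0 => //; rewrite tn0 andbT (le_trans _ nt)// ler_pM2r ?invr_gt0//.
  exact: ler_scale.
exists n; first exact: ltnW.
rewrite nt /=; case: n n0n nmin {nt} => // n _ nmin.
rewrite leNgt; apply/negP => tn; have := nmin n; rewrite ltnn => h.
suff : r n / 2 <= t by move/h.
by rewrite ltW// (le_lt_trans _ tn)// /r exprSr.
Qed.

Lemma powR_scaleK n (a : R) : 0 < a -> (r n `^ a^-1) `^ a = r n.
Proof.
by move=> a0; rewrite -powRrM mulVf ?lt0r_neq0// powRr1// ltW// scale_gt0.
Qed.

Lemma powR_scale_ratio (t a : R) : 0 < t ->
  (t `^ a^-1 / t) ^+ k = t `^ ((a^-1 - 1) * k%:R).
Proof.
move=> t0; rewrite powRrM powR_mulrn ?powR_ge0//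
  powRB ?(lt0r_neq0 t0) ?implybT//.
by rewrite powRr1// ltW.
Qed.

(** [Y n] is all of [X] for box-counting covers and a ball of [X] about [x] for homogeneous ones.
    The hypothesis on [K] makes the measures of the bad sets decay geometrically, so Borel-Cantelli
    applies. *)
Lemma ae_projection_scales x (Y : nat -> set 'rV[R]_N) (a b A : R) n1 :
  0 < b -> 0 <= A ->
  (forall n, (n1 <= n)%N ->
    exists2 K, K%:R * (r n `^ a^-1 / r n) ^+ k <= A * r n `^ b &
               ball_cover (Y n) K (r n `^ a^-1)) ->
  {ae gamma, forall W, exists n0, forall n, (n0 <= n)%N -> forall y, Y n y ->
    r n / 2 <= enorm (x - y) ->
    r n `^ a^-1 <= enorm (orthoproj (\val W) (x - y))}.
Proof.
move=> b0 A0 cover; pose q : R := 2^-1 `^ b.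
have rq n : r n `^ b = q ^+ n.
  by rewrite /r -[2^-1 ^+ n]powR_mulrn ?invr_ge0// powRAC powR_mulrn ?powR_ge0.
(* The 6 is the 3 of [ball_cover_small_projection] divided by the 1/2 in the distance bound. *)
have /choice[B BP] : forall n, exists B : set (GrBorel R hkN), [/\ measurable B,
    (gamma B <= (C * 6 ^+ k * A * q ^+ n)%:E)%E &
    (n1 <= n)%N -> forall (W : GrBorel R hkN) y, Y n y -> r n / 2 <=
      enorm (x - y) ->
      enorm (orthoproj (\val W) (x - y)) <= r n `^ a^-1 -> B W].
  move=> n; have [n1n|nn1] := leqP n1 n; last first.
    exists set0; split=> //; rewrite measure0 lee_fin.
    by rewrite !mulr_ge0// ?(ltW C0)// exprn_ge0// powR_ge0.
  have [K KA cov] := cover n n1n.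
  have r20 : 0 < r n / 2 by rewrite divr_gt0// scale_gt0.
  have d0 : 0 < r n `^ a^-1 by rewrite powR_gt0// scale_gt0.
  have [B [mB BK BW]] := ball_cover_small_projection x r20 d0 cov.
  exists B; split=> //; rewrite (le_trans BK)// lee_fin -rq.
  rewrite [leLHS](_ : _ = C * 6 ^+ k * (K%:R * (r n `^ a^-1 / r n) ^+ k)).
    by rewrite -[leRHS]mulrA ler_wpM2l// mulr_ge0// ?(ltW C0)// exprn_ge0.
  rewrite mulrCA -[RHS]mulrA [6 ^+ k * _]mulrCA -exprMn; do 2!congr (_ * _);
    congr (_ ^+ _).
  by field; rewrite lt0r_neq0// scale_gt0.
have mB n : measurable (B n) by case: (BP n).
have Bsup : gamma (lim_sup_set B) = 0%E.
  apply: lim_sup_set_cvg0 => //.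
  apply: (@nneseries_geometric_lty _ _ (C * 6 ^+ k * A) q).
  - by rewrite !mulr_ge0// ?(ltW C0)// exprn_ge0.
  - rewrite powR_ge0 /=; have <- : (1 : R) `^ b = 1 by rewrite powR1.
    by rewrite gt0_ltr_powR ?nnegrE ?invr_ge0// invf_lt1// ltr1n.
  - by move=> n; rewrite measure_ge0; case: (BP n).
exists (lim_sup_set B); split=> //.
  by apply: bigcapT_measurable => n; apply: bigcup_measurable.
move=> W; apply: contra_notP => /existsNP[n0 nB].
have {}nB n : (n0 <= n)%N -> ~ B n W by move=> ? ?; apply: nB => _; exists n.
exists (maxn n0 n1) => n; rewrite geq_max => /andP[n0n n1n] y Yy ry.
rewrite leNgt; apply/negP => lty; apply: (nB n n0n).
by case: (BP n) => _ _ /(_ n1n W y Yy ry (ltW lty)).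
Qed.

(** Apply the bound at the dyadic scale of [enorm (x - y)] itself and raise it to the power [a]. *)
Lemma scales_holder V X x (Y : nat -> set 'rV[R]_N) (a : R) n0 : 0 < a ->
  (forall n y, X y -> enorm (x - y) <= r n -> Y n y) ->
  (forall n, (n0 <= n)%N -> forall y, Y n y -> r n / 2 <= enorm (x - y) ->
    r n `^ a^-1 <= enorm (orthoproj V (x - y))) ->
  forall y, X y -> enorm (x - y) <= r n0 ->
  enorm (x - y) <= enorm (orthoproj V (x - y)) `^ a.
Proof.
move=> a0 XY scales y Xy yn0.
have [->|y0] := eqVneq (enorm (x - y)) 0; first exact: powR_ge0.
have yx0 : 0 < enorm (x - y) by rewrite lt_neqAle eq_sym y0 enorm_ge0.
have [n n0n /andP[ny yn]] := dyadic_scale yx0 yn0.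
rewrite (le_trans yn)// -[leLHS](powR_scaleK n a0).
rewrite ge0_ler_powR ?(ltW a0)// ?nnegrE ?powR_ge0 ?enorm_ge0//.
by apply: scales => //; exact: XY.
Qed.

Lemma ae_near_inverse_box X x (s a A d0 : R) : compact X ->
  0 < a -> a * k%:R < k%:R - s -> 0 <= A -> 0 < d0 ->
  (forall d, 0 < d < d0 -> exists2 K, K%:R <=
    A * d `^ (- s) & ball_cover X K d) ->
  {ae gamma, forall W, near_inverse X 0 a (\val W) x}.
Proof.
move=> cX a0 aks A0 d00 cover.
have [B B0 XB] := compact_enorm_bounded x cX.
have [n1 rn1] := scale_lt (powR_gt0 a d00).
(* The exponent of [r n] in the number of balls, -s/a, plus that in the cost of one ball, (1/a -
   1)k. *)
pose b := (k%:R - s) / a - k%:R.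
have b0 : 0 < b by rewrite subr_gt0 ltr_pdivlMr// mulrC.
have covX n : (n1 <= n)%N ->
    exists2 K, K%:R * (r n `^ a^-1 / r n) ^+ k <= A * r n `^ b &
               ball_cover X K (r n `^ a^-1).
  move=> n1n; have rn0 := scale_gt0 n.
  have [|K KA cov] := cover (r n `^ a^-1).
    rewrite powR_gt0//= -[d0 in ltRHS](powRr1 (ltW d00)) -(divff (lt0r_neq0
      a0)).
    rewrite powRrM gt0_ltr_powR ?invr_gt0// ?nnegrE ?powR_ge0 ?(ltW rn0)//.
    by rewrite (le_lt_trans _ rn1)// ler_scale.
  exists K => //.
  have -> : A * r n `^ b = (A * (r n `^ a^-1) `^ (- s)) * (r n `^ a^-1 / r n)
    ^+ k.
    by rewrite -mulrA powR_scale_ratio// -powRrM -powRD ?lt0r_neq0 ?implybT//;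
      congr (_ * _ `^ _); rewrite /b; ring.
  by rewrite ler_wpM2r// exprn_ge0// divr_ge0 ?powR_ge0// ltW.
have := ae_projection_scales x b0 A0 covX; apply: ae_imply => W [n0 scales].
have near := scales_holder a0 (fun _ _ Xy _ => Xy) scales.
exists (Num.truncn (B / r n0)).+1 => y Xy; rewrite add0r.
have [yn0|n0y] := leP (enorm (x - y)) (r n0).
  by rewrite (le_trans (near y Xy yn0))// ler_peMl ?powR_ge0// ler1n.
(* The scale [n0] also controls all farther points, since here [Y] is all of [X]; the constant then
   absorbs the diameter bound [B]. *)
have rP : r n0 <= enorm (orthoproj (\val W) (x - y)) `^ a.
  rewrite -[leLHS](powR_scaleK n0 a0).
  rewrite ge0_ler_powR ?(ltW a0)// ?nnegrE ?powR_ge0 ?enorm_ge0//.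
  apply: scales => //; apply: le_trans (ltW n0y).
  by rewrite ler_pdivrMr// ler_peMr ?(ltW (scale_gt0 _))// ler1n.
apply: (@le_trans _ _ ((Num.truncn (B / r n0)).+1%:R * r n0));
  last by rewrite ler_wpM2l.
rewrite (le_trans (XB _ Xy))// -ler_pdivrMr ?scale_gt0//.
by rewrite ltW// truncnS_gt.
Qed.

(** The factor 2 makes the bound strict, so that the infimum in the covering number yields an actual
    cover. *)
Lemma homogeneous_ball_cover X x (M s rho d : R) : 0 < M -> X x ->
  homogeneous M s X -> 0 < d -> d < rho ->
  exists2 K, K%:R <= 2 * (M * (rho / d) `^ s) &
             ball_cover (X `&` eball x rho) K d.
Proof.
move=> M0 Xx homX d0 drho.
have B0 : 0 < M * (rho / d) `^ s.
  by rewrite mulr_gt0// powR_gt0// divr_gt0// (lt_trans d0).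
have := le_lt_trans (homX x Xx rho d d0 drho) (_ : _ <
  (2 * (M * (rho / d) `^ s))%:E)%E.
case/(_ _)/covering_number_lt => [|K KM cov]; last by exists K => //;
  exact: ltW.
by rewrite lte_fin ltr_pMl// ltr1n.
Qed.

Lemma ae_near_inverse_homogeneous X x (M s a : R) : compact X -> X x ->
  0 < M -> 0 < s < k%:R -> 0 < a < 1 -> homogeneous M s X ->
  {ae gamma, forall W, near_inverse X 0 a (\val W) x}.
Proof.
move=> cX Xx M0 /andP[s0 sk] /andP[a0 a1] homX.
have [B B0 XB] := compact_enorm_bounded x cX.
have kR0 : 0 < k%:R :> R by rewrite ltr0n.
(* Homogeneity at the single radius B + 1 gives covers of box-counting type, with threshold 1 - s/k.
   Any positive exponent below it suffices for points far from [x]; this is half of it. *)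
pose a' := (1 - s / k%:R) / 2.
have a'0 : 0 < a' by rewrite divr_gt0// subr_gt0 ltr_pdivrMr// mul1r.
have far : {ae gamma, forall W, near_inverse X 0 a' (\val W) x}.
  have A0 : 0 <= 2 * (M * (B +
    1) `^ s) by rewrite !mulr_ge0 ?powR_ge0 ?(ltW M0).
  apply: (@ae_near_inverse_box X x s a' _ _ cX a'0 _ A0 (addr_gt0 B0 ltr01)).
    rewrite /a' mulrAC mulrBl mul1r divfK ?lt0r_neq0// ltr_pdivrMr//.
    by rewrite mulr_natr mulr2n ltrDl subr_gt0.
  move=> d /andP[d0 dB]; have [K KM [c cov]] :=
    homogeneous_ball_cover M0 Xx homX d0 dB.
  exists K; last first.
    exists c => y Xy; apply: cov; split=> //.
    by rewrite /eball /= (le_lt_trans (XB y Xy))// ltrDl.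
  rewrite (le_trans KM)// -!mulrA !ler_wpM2l ?(ltW M0)//.
  by rewrite powRM ?addr_ge0 ?invr_ge0 ?(ltW B0) ?(ltW d0)//
    powRN -powR_inv1 ?(ltW d0)// -powRrM mulN1r powRN.
pose b := (a^-1 - 1) * (k%:R - s).
have ainv : 0 < a^-1 - 1 by rewrite subr_gt0 invf_gt1.
have b0 : 0 < b by rewrite mulr_gt0// subr_gt0.
have A0 : 0 <= 2 * (M * 2 `^ s) by rewrite !mulr_ge0 ?powR_ge0 ?(ltW M0).
(* The radius is doubled because [eball] is open while the dyadic bound is not strict, and because
   at n = 0 the covering radius equals [r n]. *)
have near : forall n, (0 <= n)%N ->
    exists2 K, K%:R * (r n `^ a^-1 / r n) ^+ k <= 2 * (M * 2 `^ s) * r n `^ b &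
               ball_cover (X `&` eball x (2 * r n)) K (r n `^ a^-1).
  move=> n _; have rn0 := scale_gt0 n.
  have d0 : 0 < r n `^ a^-1 by rewrite powR_gt0.
  have dr : r n `^ a^-1 < 2 * r n.
    rewrite (@le_lt_trans _ _ (r n))//; last by rewrite ltr_pMl// ltr1n.
    by rewrite ge1r_powR ?rn0 ?scale_le1// invf_ge1// ltW.
  have [K KM cov] := homogeneous_ball_cover M0 Xx homX d0 dr.
  exists K => //; apply: le_trans (ler_wpM2r _ KM) _.
    by rewrite exprn_ge0// divr_ge0 ?(ltW d0) ?(ltW rn0).
  rewrite -!mulrA !ler_wpM2l ?(ltW M0)// powR_scale_ratio//.
  have -> : 2 * (r n / r n `^ a^-1) = 2 * r n `^ (1 - a^-1).
    by rewrite powRB ?(lt0r_neq0 rn0) ?implybT// powRr1// ltW.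
  rewrite powRM ?powR_ge0// -mulrA ler_wpM2l ?powR_ge0//.
  rewrite -powRrM -powRD ?(lt0r_neq0 rn0) ?implybT//.
  by rewrite /b (_ : (1 - a^-1) * s +
    (a^-1 - 1) * k%:R = (a^-1 - 1) * (k%:R - s))//; ring.
have := ae_and far (ae_projection_scales x b0 A0 near).
apply: ae_imply => W [[m xm] [n0 scales]].
have rlt n : r n < 2 * r n by rewrite ltr_pMl ?scale_gt0// ltr1n.
have nearP := scales_holder a0
  (fun n y (Xy : X y) yn => conj Xy (le_lt_trans yn (rlt n))) scales.
(* If [enorm (x - y)] exceeds [r n0], the estimate with exponent [a'] bounds the projected distance
   below; [p] is that bound raised to the power [a]. *)
pose p := (r n0 / m.+1%:R) `^ (a / a').
have rm0 : 0 < r n0 / m.+1%:R by rewrite divr_gt0 ?scale_gt0.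
have p0 : 0 < p by rewrite powR_gt0.
exists (Num.truncn (B / p)).+1 => y Xy; rewrite add0r.
have [yn0|n0y] := leP (enorm (x - y)) (r n0).
  by rewrite (le_trans (nearP y Xy yn0))// ler_peMl ?powR_ge0// ler1n.
set t := enorm (orthoproj _ _).
have t0 : 0 <= t := enorm_ge0 _.
have pt : p <= t `^ a.
  rewrite -[a in leRHS](divfK (lt0r_neq0 a'0)) mulrC powRrM.
  rewrite ge0_ler_powR ?nnegrE ?powR_ge0// ?(ltW rm0)//.
    by rewrite divr_ge0// ltW.
  rewrite ler_pdivrMr// mulrC (le_trans (ltW n0y))// (le_trans (xm y Xy))//.
  by rewrite add0r ler_wpM2r ?powR_ge0// ler_nat.
apply: (@le_trans _ _ ((Num.truncn (B / p)).+1%:R * p));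
  last by rewrite ler_wpM2l.
rewrite (le_trans (XB _ Xy))// -ler_pdivrMr//.
by rewrite ltW// truncnS_gt.
Qed.

End Scales.

(** * Inverses of projections *)

Lemma upper_box_dim_lt_cover {R : realType} {N : nat} (X : set 'rV[R]_N) (s :
  R) :
  (upper_box_dim X < s%:E)%E -> exists2 d0, 0 < d0 & forall d, 0 < d < d0 ->
    exists2 K, K%:R <= 1 * d `^ (- s) & ball_cover X K d.
Proof.
move=> /ereal_inf_lt[_ [V [e /= e0 eV] <-] supV].
(* Radii below 1 make - ln d positive, so one can multiply by it. *)
exists (Num.min e 1) => [|d]; first by rewrite lt_min e0 ltr01.
rewrite lt_min => /and3P[d0 de d1].
have lnd : 0 < - ln d by rewrite oppr_gt0 ln_lt0// d0.
have : (lne (covering_number X d) / (- ln d)%:E < s%:E)%E.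
  apply: le_lt_trans supV; apply: ereal_sup_ubound; exists d => //.
  by apply: eV => //=; rewrite sub0r normrN gtr0_norm.
have lt_cov : (lne (covering_number X d) < (s * - ln d)%:E)%E ->
    (covering_number X d < (d `^ (- s))%:E)%E.
  have : (0 <= covering_number X d)%E.
    by apply: le_ereal_inf_tmp => _ [n _ <-]; rewrite lee_fin.
  case: covering_number => [n| |] //=; rewrite lee_fin => n0.
  case: ifPn => [n0' _|]; first by rewrite lte_fin (le_lt_trans n0')// powR_gt0.
  rewrite -ltNge !lte_fin => n0'; rewrite mulrN -mulNr -ln_powR.
  by rewrite ltr_ln// posrE powR_gt0.
rewrite inver gt_eqF// lte_pdivrMr// -EFinM =>
  /lt_cov /covering_number_lt[K KM cov].
by exists K => //; rewrite mul1r ltW.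
Qed.

(** Countably many exponents cofinal below the threshold allow one exceptional null set for all of
    them. The value +oo arises from an upper box dimension equal to -oo. *)
Lemma exists_seq_below {R : realType} (L : \bar R) : (0 < L)%E ->
  exists a : nat -> R, (forall n, 0 < a n /\ ((a n)%:E < L)%E) /\
    forall c : R, (c%:E < L)%E -> exists n, c <= a n.
Proof.
case: L => [l| |] //; rewrite ?lte_fin => l0.
  (* With [n.+1] the term at n = 0 would be 0. *)
  exists (fun n => l - l / n.+2%:R); split=> [n|c].
    split; last by rewrite lte_fin ltrBlDr ltrDl divr_gt0.
    by rewrite subr_gt0 ltr_pdivrMr// ltr_pMr// ltr1n.
  rewrite lte_fin => cl; have lc0 : 0 < l - c by rewrite subr_gt0.
  exists (Num.truncn (l / (l - c))); rewrite lerBrDl -lerBrDr.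
  rewrite ler_pdivrMr// -ler_pdivrMl// mulrC ltW//.
  by rewrite (lt_trans (truncnS_gt _))// ltr_nat.
exists (fun n => n.+1%:R); split=> [n|c _]; first by rewrite ltr0n ltry.
by exists (Num.truncn c); rewrite ltW// truncnS_gt.
Qed.

Section Inverse.
Context {R : realType} {N : nat}.
Implicit Types (x y : 'rV[R]_N) (V : {vspace 'rV[R]_N}) (X XV : set 'rV[R]_N).

Lemma inverse_onK XV V x : set_inj XV (orthoproj V) -> XV x ->
  inverse_on XV (orthoproj V) (orthoproj V x) = x.
Proof. by move=> injV XVx; rewrite /inverse_on pinvKV ?inE. Qed.

(** With equal projections the estimate leaves only 1/(n+1), for every n: this is injectivity. For
    continuity, half of the tolerance goes to 1/(n+1) and half to the projected distance. *)
Lemma continuous_inverse_near_inverse X XV V : XV `<=` X ->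
  (forall n x, XV x -> near_inverse X n.+1%:R^-1 1 V x) ->
  set_inj XV (orthoproj V) /\
  {within orthoproj V @` XV, continuous (inverse_on XV (orthoproj V))}.
Proof.
move=> XVX near.
have injV : set_inj XV (orthoproj V).
  move=> x y; rewrite !inE => XVx XVy Pxy; apply/eqP; rewrite -subr_eq0.
  apply/eqP/enorm_eq0/eqP; rewrite eq_le enorm_ge0 andbT.
  apply/ler_addgt0Pr => e e0; rewrite add0r.
  have [m xm] := near (Num.truncn e^-1) x XVx.
  rewrite (le_trans (xm y (XVX _ XVy)))// linearB /= Pxy subrr enorm0.
  rewrite powRr1// mulr0 addr0 invf_ple ?posrE//.
  by rewrite ltW// truncnS_gt.
split=> //; apply/subspace_continuousP => _ [x XVx <-] B.
rewrite /from_subspace inverse_onK// => /nbhs_ballP[e /= e0 eB].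
have e20 : 0 < e / 2 by rewrite divr_gt0.
pose n := Num.truncn (e / 2)^-1.
have ne : n.+1%:R^-1 < e / 2 by rewrite invf_plt ?posrE// truncnS_gt.
have [m xm] := near n x XVx.
pose h := e / 2 / (m * N).+1%:R; have h0 : 0 < h by rewrite divr_gt0.
apply/nbhs_ballP; exists h => //= z [_ Pxy] [y XVy yE]; apply: eB.
move: Pxy; rewrite -yE inverse_onK// => Pxy.
have Pxy_le : enorm (orthoproj V (x - y)) <= N%:R * h.
  rewrite linearB; apply: enorm_le_coord (ltW h0) _ => i.
  by rewrite !mxE ltW//; exact: Pxy.
have xy : enorm (x - y) < e.
  rewrite (le_lt_trans (xm y (XVX _ XVy)))// powRr1 ?enorm_ge0//.
  rewrite [e]splitr ltr_leD// (le_trans (ler_wpM2l _ Pxy_le))//.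
  rewrite mulrA -natrM mulrCA ler_piMr ?(ltW e20)//.
  by rewrite ler_pdivrMr// mul1r ler_nat.
split=> // i j; rewrite ord1 /ball /= (le_lt_trans _ xy)//.
by have := coord_le_enorm (x - y) j; rewrite !mxE.
Qed.

Lemma powR_le_bounded (t B a c : R) : 0 <= t <= B -> 0 < c <= a ->
  t `^ a <= B `^ (a - c) * t `^ c.
Proof.
move=> /andP[t0 tB] /andP[c0 ca]; have a0 := lt_le_trans c0 ca.
have [->|tn0] := eqVneq t 0; first by rewrite !powR0 ?mulr0// lt0r_neq0.
rewrite -{1}(subrK c a) [t `^ _]powRD ?tn0 ?implybT// ler_wpM2r ?powR_ge0//.
by rewrite ge0_ler_powR ?subr_ge0// nnegrE (le_trans t0).
Qed.

Lemma holder_inverse_near_inverse X XV V (a : nat -> R) :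
  compact X -> XV `<=` X -> (forall n, 0 < a n) ->
  (forall n x, XV x -> near_inverse X 0 (a n) V x) ->
  set_inj XV (orthoproj V) /\ forall c, 0 < c -> (exists n, c <= a n) ->
  pointwise_holder c (orthoproj V @` XV) (inverse_on XV (orthoproj V)).
Proof.
move=> cX XVX a0 near.
have injV : set_inj XV (orthoproj V).
  move=> x y; rewrite !inE => XVx XVy Pxy; apply/eqP; rewrite -subr_eq0.
  apply/eqP/enorm_eq0/eqP; rewrite eq_le enorm_ge0 andbT.
  have [m xm] := near 0%N x XVx; rewrite (le_trans (xm y (XVX _ XVy)))//.
  by rewrite linearB /= Pxy subrr enorm0 powR0 ?mulr0 ?addr0// lt0r_neq0.
split=> // c c0 [n ca] _ [x XVx <-].
have [m xm] := near n x XVx; have [B B0 XB] := compact_enorm_bounded x cX.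
(* The power of [B] is the price of lowering the exponent from [a n] to [c] on a bounded set; the 1
   keeps the constant positive. *)
exists (m%:R * B `^ (a n - c) + 1).
  by rewrite ltr_wpDl// mulr_ge0// powR_ge0.
move=> _ [y XVy <-]; rewrite !inverse_onK// -linearB.
rewrite (le_trans (xm y (XVX _ XVy)))// add0r mulrDl mul1r ler_wpDr ?powR_ge0//.
rewrite -mulrA ler_wpM2l// powR_le_bounded ?c0// enorm_ge0 /=.
by rewrite (le_trans (enorm_orthoproj _ _))// XB//; exact: XVX.
Qed.

End Inverse.

(** The strict inequality leaves room between [D] and k - a k: take the midpoint, or any smaller
    real when [D] is -oo. *)
Lemma upper_box_real_bound {R : realType} (D : \bar R) (k : nat) (a : R) :
  (0 < k)%N -> (D < +oo)%E -> (a%:E < 1 - D / k%:R%:E)%E ->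
  exists2 s : R, (D < s%:E)%E & a * k%:R < k%:R - s.
Proof.
move=> k0; have kR0 : 0 < k%:R :> R by rewrite ltr0n.
case: D => [d| |] // _.
  rewrite inver gt_eqF// -EFinM -EFinB lte_fin => ad.
  have dk : a * k%:R < k%:R - d.
    by rewrite -ltr_pdivlMr// mulrBl divff// lt0r_neq0.
  exists ((d + (k%:R - a * k%:R)) / 2); first by rewrite lte_fin; lra.
  by lra.
by exists (k%:R - a * k%:R - 1); [exact: ltNyr|lra].
Qed.

Theorem theorem1p7 (R : realType) (N k : nat) (hk : (0 < k)%N)
    (hkN : (k <= N)%N)
    (gamma : probability (GrBorel R hkN) R) (hgamma : rotation_invariant gamma)
    (X : set 'rV[R]_N) (hX : compact X)
    (mu : {finite_measure set (Borel R N) -> \bar R})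
    (hmu : mu (~` X) = 0%E) :
  [/\ (hausdorff_dim X < k%:R%:E)%E ->
      {ae gamma, forall V, exists2 XV : set 'rV[R]_N,
        full_borel_subset mu X XV &
        set_inj XV (orthoproj (\val V)) /\
        {within orthoproj (\val V) @` XV,
          continuous (inverse_on XV (orthoproj (\val V)))}},
      (upper_box_dim X < k%:R%:E)%E ->
      {ae gamma, forall V, exists2 XV : set 'rV[R]_N,
        full_borel_subset mu X XV &
        set_inj XV (orthoproj (\val V)) /\
        forall alpha : R, 0 < alpha ->
          (alpha%:E < 1 - upper_box_dim X / k%:R%:E)%E ->
          pointwise_holder alpha (orthoproj (\val V) @` XV)
            (inverse_on XV (orthoproj (\val V)))} &
      (assouad_dim X < k%:R%:E)%E ->
      {ae gamma, forall V, exists2 XV : set 'rV[R]_N,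
        full_borel_subset mu X XV &
        set_inj XV (orthoproj (\val V)) /\
        forall alpha : R, 0 < alpha -> alpha < 1 ->
          pointwise_holder alpha (orthoproj (\val V) @` XV)
            (inverse_on XV (orthoproj (\val V)))}].
Proof.
have [C C0 transversal] := small_projection_le hgamma hk.
have kR0 : 0 < k%:R :> R by rewrite ltr0n.
split=> dimX.
- have near n x : X x -> {ae gamma, forall W,
    near_inverse X n.+1%:R^-1 1 (\val W) x}.
    move=> Xx; apply: (ae_near_inverse_hausdorff hk C0 transversal hX Xx _
      dimX).
    by rewrite invr_gt0.
  have := ae_full_near_inverse (a := fun=> 1) hX hmu (fun=> ltr01) near.
  apply: ae_imply => V [XV fXV XVnear]; exists XV => //.
  by have [_ XVX _] := fXV; exact: continuous_inverse_near_inverse XVX XVnear.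
- have L0 : (0 < 1 - upper_box_dim X / k%:R%:E)%E.
    case: (upper_box_dim X) dimX => [d| |] //; last first.
      by move=> _; rewrite inver gt_eqF// gt0_mulNye ?lte_fin ?invr_gt0// ltry.
    rewrite inver gt_eqF// -EFinM -EFinB !lte_fin => dk.
    by rewrite subr_gt0 ltr_pdivrMr// mul1r.
  have [a [aP a_dense]] := exists_seq_below L0.
  have a0 n : 0 < a n by case: (aP n).
  have near n x : X x -> {ae gamma, forall W,
    near_inverse X 0 (a n) (\val W) x}.
    move=> Xx; have [_ aL] := aP n.
    have [s /upper_box_dim_lt_cover[d0 d00 cover] aks] :=
      upper_box_real_bound hk (lt_trans dimX (ltry _)) aL.
    exact: (ae_near_inverse_box C0 transversal x hX (a0 n) aks ler01 d00 cover).
  have := ae_full_near_inverse (e := fun=> 0) hX hmu a0 near.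
  apply: ae_imply => V [XV fXV XVnear]; exists XV => //.
  have [_ XVX _] := fXV.
  have [injV holderV] := holder_inverse_near_inverse hX XVX a0 XVnear.
  by split=> // c c0 cL; apply: holderV => //; exact: a_dense.
have [a [aP a_dense]] := @exists_seq_below R 1%:E lte01.
have a0 n : 0 < a n by case: (aP n).
have near n x : X x -> {ae gamma, forall W, near_inverse X 0 (a n) (\val W) x}.
  move=> Xx; have [_ aL] := aP n.
  have [_ [s [s0 [M M0 homX]] <-] sk] := ereal_inf_lt dimX.
  apply: (ae_near_inverse_homogeneous hk C0 transversal hX Xx M0 _ _ homX).
    by rewrite s0 -lte_fin.
  by rewrite a0 -lte_fin.
have := ae_full_near_inverse (e := fun=> 0) hX hmu a0 near.
apply: ae_imply => V [XV fXV XVnear]; exists XV => //.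
have [_ XVX _] := fXV.
have [injV holderV] := holder_inverse_near_inverse hX XVX a0 XVnear.
by split=> // c c0 cL; apply: holderV => //; apply: a_dense; rewrite lte_fin.
Qed.
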